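(* $$\lim_{c\to\infty}\sigma(c\text{-VSP-Circuit-SAT}/n)\le\lim_{k\to\infty}\sigma(k\text{-CNF-SAT}/n).$$
   Context: For a problem $\Pi$ with input size $m$ and parameter $n$, $\sigma(\Pi/n)$ is the infimum of all $\epsilon>0$ such that $\Pi$ has a randomized algorithm with error probability at most $1/3$ running in time $2^{\epsilon n}\mathrm{poly}(m)$. $k$-CNF-SAT: satisfiability of $n$-variable CNF formulas with clauses of size at most $k$. A multidag is a directed acyclic multigraph; input$(G)$ / output$(G)$ are the vertices of indegree / outdegree zero. A labeling is $l:V\to\mathbb N$ with $l(u)<l(v)$ for every edge $(u,v)$; it is normal if $l(v)=0$ on inputs and there is $d$ with $l(v)=d$ for all $v\in$ output$(G)\setminus$ input$(G)$. $G$ is Valiant series-parallel (VSP) if it has a normal labeling with no two edges $(u,v),(u',v')$ with $l(u)<l(u')<l(v)<l(v')$. A VSP circuit is a Boolean circuit whose underlying multidag is VSP and whose gates have fan-in at most two; its size is its number of wires. $c$-VSP-Circuit-SAT: given an $n$-input VSP circuit of size at most $cn$, decide satisfiability. *)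

(* Defs.v *)
From mathcomp Require Import all_boot all_order all_algebra.
From mathcomp Require Import all_classical all_reals all_analysis.

Set Implicit Arguments.
Unset Strict Implicit.
Unset Printing Implicit Defensive.

Import Order.TTheory GRing.Theory Num.Theory.
Import numFieldNormedType.Exports.

Local Open Scope nat_scope.

(** The machine model is the WHILE language on binary trees of N. D. Jones
    ("Computability and Complexity from a Programming Perspective"), extended
    with a fair coin.  Trees are LISP-like data: [Node] and the two projections
    are unit-cost pointer operations, and there is no unit-cost test that
    inspects more than the root of a tree.  Such a program and a
    logarithmic-cost random-access machine simulate each other with overhead
    polynomial in the logarithm of the running time.  For running times of the
    form [2 ^ (eps * n) * poly(m)] with [n <= m] this is a factor [poly(m)], so
    the exponents [sigma] below are those of random-access machines. *)

Inductive tree := Leaf | Node of tree & tree.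

Definition left_tree (t : tree) := if t is Node a _ then a else Leaf.
Definition right_tree (t : tree) := if t is Node _ b then b else Leaf.

(** Truth values: [Leaf] is false, every other tree is true. *)
Definition truth (t : tree) : bool := if t is Node _ _ then true else false.
Definition tree_of_bool (b : bool) : tree := if b then Node Leaf Leaf else Leaf.

Fixpoint tree_size (t : tree) : nat :=
  if t is Node a b then (tree_size a + tree_size b).+1 else 1.

Inductive expr :=
  | EVar of nat
  | ELeaf
  | ENode of expr & expr
  | ELeft of expr
  | ERight of expr.

Inductive com :=
  | Skip
  | Assign of nat & expr
  | Flip of nat
  | Seq of com & com
  | If of expr & com & com
  | While of expr & com.

Definition store := nat -> tree.

Definition upd (s : store) (x : nat) (t : tree) : store :=
  fun y => if y == x then t else s y.

Fixpoint eval_expr (s : store) (e : expr) : tree :=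
  match e with
  | EVar x => s x
  | ELeaf => Leaf
  | ENode e1 e2 => Node (eval_expr s e1) (eval_expr s e2)
  | ELeft e1 => left_tree (eval_expr s e1)
  | ERight e1 => right_tree (eval_expr s e1)
  end.

(** The commands still to be executed, the store and the unread coins. *)
Definition config := (seq com * store * seq bool)%type.

(** One step costs one unit of time: the expressions of a program have bounded
    size, so a step is a bounded number of elementary tree operations.  A step
    reads at most one coin. *)
Definition step (c : config) : config :=
  let: (k, s, r) := c in
  match k with
  | [::] => ([::], s, r)
  | Skip :: k' => (k', s, r)
  | Assign x e :: k' => (k', upd s x (eval_expr s e), r)
  | Flip x :: k' => (k', upd s x (tree_of_bool (head false r)), behead r)
  | Seq a b :: k' => (a :: b :: k', s, r)
  | If e a b :: k' => ((if truth (eval_expr s e) then a else b) :: k', s, r)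
  | While e a :: k' =>
      ((if truth (eval_expr s e) then [:: a, While e a & k'] else k'), s, r)
  end.

(** The input and the answer are in variable 0; all other variables start as
    [Leaf].  The result is [None] if the program has not halted within [T]
    steps. *)
Definition run (prog : com) (T : nat) (input : tree) (r : seq bool) :
    option bool :=
  let: (k, s, _) :=
    iter T step ([:: prog], (fun x => if x == 0 then input else Leaf), r) in
  if k is [::] then Some (truth (s 0)) else None.

(** An algorithm for a problem need only be correct on legal instances. *)
Record problem := Problem {
  instance : Type;
  legal : instance -> Prop;
  encode : instance -> tree;
  param : instance -> nat;
  answer : instance -> bool
}.

Definition input_size (P : problem) (x : instance P) : nat :=
  tree_size (encode x).

(** Within [T] steps a program reads at most [T] coins, so its coins can be
    taken uniformly from the bit strings of length [T]. *)
Definition error_prob (R : realType) (P : problem) (prog : com) (T : nat)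
    (x : instance P) : R :=
  (#|[pred r : T.-tuple bool |
       run prog T (encode x) r != Some (answer x)]|%:R
   / #|{: T.-tuple bool}|%:R)%R.

(** [P] has a randomized algorithm with (two-sided) error at most 1/3 and
    worst-case running time at most [2 ^ (eps * n) * p(m)], for a polynomial
    [p], on instances with parameter [n] and input size [m]. *)
Definition solvable_in (R : realType) (P : problem) (eps : R) : Prop :=
  exists (prog : com) (p : {poly R}),
    forall x : instance P, legal x ->
      exists T : nat,
        [/\ (T%:R <= 2 `^ (eps * (param x)%:R) * p.[(input_size x)%:R])%R,
            forall r : T.-tuple bool, run prog T (encode x) r != None
          & (error_prob R prog T x <= 1 / 3)%R].

Definition sigma (R : realType) (P : problem) : \bar R :=
  ereal_inf [set eps%:E | eps in [set e : R | (0 < e)%R /\ solvable_in P e]].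

(** Natural numbers are written in unary.  Thus the input size is at least the
    parameter in both problems below, and differs polynomially from the size
    obtained by writing indices in binary. *)

Definition enc_nat (n : nat) : tree := iter n (Node Leaf) Leaf.

Definition enc_seq (A : Type) (enc : A -> tree) (s : seq A) : tree :=
  foldr (fun a t => Node (enc a) t) Leaf s.

(** The literal [(b, i)] is satisfied when variable [i] has value [b]. *)
Record cnf := Cnf {
  nvars : nat;
  clauses : seq (seq (bool * 'I_nvars))
}.

Definition cnf_eval (phi : cnf) (x : {ffun 'I_(nvars phi) -> bool}) : bool :=
  all (fun cl => has (fun l => x l.2 == l.1) cl) (clauses phi).

Definition cnf_sat (phi : cnf) : bool :=
  [exists x : {ffun 'I_(nvars phi) -> bool}, cnf_eval x].

Definition is_kcnf (k : nat) (phi : cnf) : Prop :=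
  all (fun cl => size cl <= k) (clauses phi).

Definition enc_cnf (phi : cnf) : tree :=
  Node (enc_nat (nvars phi))
    (enc_seq (enc_seq (fun l : bool * 'I_(nvars phi) => Node (tree_of_bool l.1) (enc_nat l.2)))
       (clauses phi)).

Definition kCNF_SAT (k : nat) : problem :=
  {| instance := cnf; legal := is_kcnf k; encode := enc_cnf;
     param := nvars; answer := cnf_sat |}.

(** Parallel edges are repeated entries of [edges]. *)
Record multidigraph := Multidigraph {
  order : nat;
  edges : seq ('I_order * 'I_order)
}.

Section Multidigraph.
Variable G : multidigraph.

Definition adj : rel 'I_(order G) := fun u v => (u, v) \in edges G.

Definition acyclic : bool :=
  [forall u, forall v, adj u v ==> ~~ connect adj v u].

(** The origins of the edges into [v], with multiplicity, in the order of
    [edges]. *)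
Definition preds (v : 'I_(order G)) : seq 'I_(order G) :=
  [seq e.1 | e <- edges G & e.2 == v].

Definition succs (v : 'I_(order G)) : seq 'I_(order G) :=
  [seq e.2 | e <- edges G & e.1 == v].

Definition is_input (v : 'I_(order G)) : bool := size (preds v) == 0.
Definition is_output (v : 'I_(order G)) : bool := size (succs v) == 0.

Definition labeling (l : 'I_(order G) -> nat) : Prop :=
  forall e, e \in edges G -> l e.1 < l e.2.

Definition normal (l : 'I_(order G) -> nat) : Prop :=
  (forall v, is_input v -> l v = 0) /\
  (exists d, forall v, is_output v -> ~~ is_input v -> l v = d).

Definition VSP : Prop :=
  acyclic /\
  exists l : 'I_(order G) -> nat,
    [/\ labeling l, normal l
      & forall e e', e \in edges G -> e' \in edges G ->
          ~~ [&& l e.1 < l e'.1, l e'.1 < l e.2 & l e.2 < l e'.2]].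

End Multidigraph.

(** The input variables are the vertices of indegree zero; every other vertex
    [v] is a gate computing the Boolean function [gate v], and [out] carries the
    output.  A gate with wires from [a] and [b] (in this order) has the value
    [gate v (a, b)] and a gate with one wire, from [a], the value
    [gate v (a, false)], so all functions of at most two arguments occur. *)
Record circuit := Circuit {
  dag : multidigraph;
  gate : {ffun 'I_(order dag) -> {ffun bool * bool -> bool}};
  out : 'I_(order dag)
}.

Section Circuit.
Variable C : circuit.
Local Notation vertex := 'I_(order (dag C)).

Definition gate_value (val : vertex -> bool) (v : vertex) : bool :=
  gate C v (nth false (map val (preds v)) 0, nth false (map val (preds v)) 1).

(** The value of [v] when the inputs are assigned [x], unfolding at most [d]
    levels; a path of an acyclic circuit has at most [order (dag C)] vertices,
    so [eval_circuit] unfolds completely (see [eval_circuitE]). *)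
Fixpoint eval_upto (d : nat) (x : {ffun {v : vertex | is_input v} -> bool})
    (v : vertex) : bool :=
  if d is d'.+1 then
    if insub v is Some i then x i else gate_value (eval_upto d' x) v
  else false.

Definition eval_circuit (x : {ffun {v : vertex | is_input v} -> bool})
    (v : vertex) : bool :=
  eval_upto (order (dag C)) x v.

Definition circuit_sat : bool := [exists x, eval_circuit x (out C)].

Definition num_inputs : nat := #|[pred v : vertex | is_input v]|.

Definition circuit_size : nat := size (edges (dag C)).

Definition VSP_circuit : Prop :=
  [/\ VSP (dag C), forall v : vertex, size (preds v) <= 2
    & is_output (out C)].

(** The vertices are listed as the truth tables of their gates. *)
Definition enc_circuit : tree :=
  Node (enc_nat (out C))
    (Node
      (enc_seq (fun e : vertex * vertex => Node (enc_nat e.1) (enc_nat e.2))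
         (edges (dag C)))
      (enc_seq
         (fun v => enc_seq (fun ab => tree_of_bool (gate C v ab))
            [:: (false, false); (false, true); (true, false); (true, true)])
         (enum 'I_(order (dag C))))).

End Circuit.

Definition VSP_CIRCUIT_SAT (R : realType) (c : R) : problem :=
  {| instance := circuit;
     legal := fun C =>
       VSP_circuit C /\ ((circuit_size C)%:R <= c * (num_inputs C)%:R)%R;
     encode := enc_circuit; param := num_inputs; answer := circuit_sat |}.

Lemma eval_circuitE (C : circuit) x (v : 'I_(order (dag C))) :
  acyclic (dag C) ->
  eval_circuit x v =
    if insub v is Some i then x i else gate_value (eval_circuit x) v.
Proof.
move=> /forallP acy.
pose anc (w : 'I_(order (dag C))) := [pred u | connect (@adj (dag C)) u w].
have pred_adj (w u : 'I_(order (dag C))) : u \in preds w -> adj u w.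
  by case/mapP=> -[a b]; rewrite mem_filter /= => /andP[/eqP -> ?] ->.
have ancS (w u : 'I_(order (dag C))) : adj u w -> #|anc u| < #|anc w|.
  move=> uw; apply: proper_card; apply/properP; split.
    by apply/fintype.subsetP => z; rewrite !inE => zu; apply: connect_trans zu (connect1 uw).
  by exists w; rewrite !inE ?connect0 //; have /forallP/(_ w)/implyP := acy u; apply.
have ev_eq n : forall d d' w, #|anc w| <= n -> n <= d -> n <= d' ->
    eval_upto d x w = eval_upto d' x w.
  elim: n => [|n IH] [|d] [|d'] w //=.
  - by rewrite leqn0 => /eqP /card0_eq /(_ w); rewrite !inE connect0.
  - by rewrite leqn0 => /eqP /card0_eq /(_ w); rewrite !inE connect0.
  - by rewrite leqn0 => /eqP /card0_eq /(_ w); rewrite !inE connect0.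
  move=> Hw nd nd'; case: (insub w) => // .
  have E : map (eval_upto d x) (preds w) = map (eval_upto d' x) (preds w).
    apply/eq_in_map => u /pred_adj /ancS lt_uw; apply: IH => //.
    by rewrite -ltnS; apply: leq_trans Hw.
  by rewrite /gate_value E.
rewrite {1}/eval_circuit (@ev_eq #|anc v| _ (order (dag C)).+1 v) //.
  by rewrite -[X in _ <= X](card_ord (order (dag C))) max_card.
by apply: leqW; rewrite -[X in _ <= X](card_ord (order (dag C))) max_card.
Qed.

(** Both exponents are nondecreasing in the width or size bound, hence
    converge. *)
Lemma sigma_le (R : realType) (I : Type) (L L' : I -> Prop) enc par ans :
  (forall x, L x -> L' x) ->
  (sigma R (@Problem I L enc par ans) <= sigma R (@Problem I L' enc par ans))%E.
Proof.
move=> LL'; apply: ereal_inf_le_tmp => _ [e [e0 [prog [p H]]] <-].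
by exists e => //; split=> //; exists prog, p => x /LL' /H.
Qed.

Lemma is_cvg_sigma_kCNF (R : realType) :
  cvgn (fun k : nat => sigma R (kCNF_SAT k)).
Proof.
apply: ereal_nondecreasing_is_cvgn => k k' kk'; apply: sigma_le => phi.
by apply: sub_all => cl ?; apply: leq_trans kk'.
Qed.

Lemma is_cvg_sigma_VSP (R : realType) :
  cvg (sigma R (VSP_CIRCUIT_SAT c) @[c --> (+oo%R : set_system R)])%classic.
Proof.
apply/cvg_ex; eexists; apply: nondecreasing_cvge => c c' cc'.
apply: sigma_le => C [? H]; split=> //; apply: (le_trans H).
by rewrite ler_wpM2r.
Qed.

(* Main.v *)
Require Import Defs.
From mathcomp Require Import all_boot all_order all_algebra.
From mathcomp Require Import all_classical all_reals all_analysis.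
From mathcomp Require Import zify ring lra.
Import numFieldNormedType.Exports.

(** Let the labels of a VSP graph with [m] wires be given.  The intervals
    between the labels of the ends of the wires form a laminar family, so the
    label line splits recursively as a binary series-parallel tree.  A path
    that climbs in this tree passes through right siblings, one that descends
    through left siblings; blocking, by recursively chosen minimum cuts, the
    siblings at every [K]-th such turn removes at most [2 * m / K] wires and
    leaves only paths of length bounded in [K].  Hence, if the gates at the
    tails of the removed wires become variables, every gate depends on boundedly
    many variables, and satisfiability of a circuit with [n] inputs and at most
    [c * n] wires is that of a k-CNF in [(1 + delta) * n] variables.

    The cut is found without knowing the labels, by trying all sets of at most
    [delta * n] gates; there are [2 ^ (delta' * n)] of these, where [delta']
    tends to 0 with [delta].  The solver for k-CNF is called only once, on the
    formula of a good cut, so its error is not amplified. *)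

Set Implicit Arguments.
Unset Strict Implicit.
Unset Printing Implicit Defensive.

Import Order.TTheory GRing.Theory Num.Theory.
Local Open Scope nat_scope.

(** * Programs as polynomial-time functions on trees *)

(** The solvers are given for each [k] separately, with no uniformity in [k], so the width must be
    fixed before any circuit is seen: it depends only on [q], and [q] only on [c] and on two
    exponents [e' < e]. A cut with [K = 2 * q] names at most [circuit_size / q <= c * n / q] gates.
    The gap [e - e'] pays for these additional variables, and the exponent [e] itself bounds the
    search.

    Climbing and descending need separate counters because a sibling crossed from end to end is
    split again: in each half of it one of the two counters goes down, which bounds a complete
    crossing by [2 ^ (i + j)] wires. Summed over all [K] starting values, a counter removes no more
    than the total number of wires, so that some starting value removes at most a fraction [1 / K].

    The programs have loops but no recursion and no lists. The construction of the clauses therefore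
    appears twice, on sequences and, through folds, on trees. *)

Definition polyb (T : tree -> nat) : Prop :=
  exists a, forall x, T x <= (tree_size x).+2 ^ a.

Lemma polyb_le (T T' : tree -> nat) :
  polyb T' -> (forall x, T x <= T' x) -> polyb T.
Proof. by move=> [a Ha] le; exists a => x; apply: leq_trans (le x) (Ha x). Qed.

(** The [.+2] in [polyb] keeps the base at least 2, so that larger exponents absorb constants, sums
    and products. *)
Lemma polyb_const c : polyb (fun=> c).
Proof.
exists c => x; apply: leq_trans (ltnW (ltn_expl c (isT : 1 < 2))) _.
by case: c => // c; rewrite leq_exp2r.
Qed.

Lemma polyb_size : polyb tree_size.
Proof. by exists 1 => x; rewrite expn1 leqW. Qed.

Lemma polyb_mul S T : polyb S -> polyb T -> polyb (fun x => S x * T x).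
Proof.
by move=> [a Ha] [b Hb]; exists (a + b) => x; rewrite expnD leq_mul.
Qed.

Lemma polyb_add S T : polyb S -> polyb T -> polyb (fun x => S x + T x).
Proof.
move=> HS HT; apply: (@polyb_le _ (fun x => (S x).+1 * (T x).+1)); last first.
  by move=> x; nia.
have polybS U : polyb U -> polyb (fun x => (U x).+1).
  move=> [a Ha]; exists a.+1 => x; rewrite expnS.
  have := Ha x; have : 0 < (tree_size x).+2 ^ a by rewrite expn_gt0.
  by nia.
by apply: polyb_mul; apply: polybS.
Qed.

Lemma polyb_comp T f : polyb T -> polyb (fun x => tree_size (f x)) ->
  polyb (fun x => T (f x)).
Proof.
move=> [a Ha] /polyb_add /(_ (polyb_const 2)) [b Hb]; exists (b * a) => x.
apply: leq_trans (Ha (f x)) _; rewrite expnM.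
by case: (a) => // a'; rewrite leq_exp2r// -[_.+2]addn2.
Qed.

Lemma polyb_exp T a : polyb T -> polyb (fun x => T x ^ a).
Proof.
move=> HT; elim: a => [|a IH]; first exact: (polyb_const 1).
by apply: (@polyb_le _ (fun x => T x * T x ^ a)) (polyb_mul HT IH) _ => x; rewrite expnS.
Qed.

(** All variables but 0 stay [Leaf] during the reduction, so its final store is the initial store of
    the solver on the computed formula. *)
Definition st (v : tree) : store := fun x => if x == 0 then v else Leaf.

Lemma upd_st v w : upd (st v) 0 w = st w.
Proof. by apply: funext => x; rewrite /upd /st; case: (x == 0). Qed.

(** The continuation and the coins are arbitrary and untouched, which makes runs composable and
    leaves every coin to the solver. *)
Definition runs (c : com) (v w : tree) (T : nat) : Prop :=
  exists2 t, t <= T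
    & forall k r, iter t step (c :: k, st v, r) = (k, st w, r).

Lemma runs_le c v w T T' : runs c v w T -> T <= T' -> runs c v w T'.
Proof. by move=> [t tT H] TT'; exists t => //; apply: leq_trans TT'. Qed.

Lemma runs_assign e v : runs (Assign 0 e) v (eval_expr (st v) e) 1.
Proof. by exists 1 => // k r; rewrite /= upd_st. Qed.

Lemma runs_seq a b v v1 v2 T1 T2 :
  runs a v v1 T1 -> runs b v1 v2 T2 -> runs (Seq a b) v v2 (T1 + T2).+1.
Proof.
move=> [t1 t1T H1] [t2 t2T H2]; exists (t2 + t1).+1; first by lia.
by move=> k r; rewrite iterSr iterD H1 H2.
Qed.

Lemma runs_if e a b v w T :
  runs (if truth (eval_expr (st v) e) then a else b) v w T ->
  runs (If e a b) v w T.+1.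
Proof. by move=> [t tT H]; exists t.+1 => // k r; rewrite iterSr H. Qed.

Lemma runs_while_stop e a v :
  ~~ truth (eval_expr (st v) e) -> runs (While e a) v v 1.
Proof. by move=> /negbTE h; exists 1 => // k r; rewrite /= h. Qed.

Lemma runs_while_next e a v v1 v2 T1 T2 : truth (eval_expr (st v) e) ->
  runs a v v1 T1 -> runs (While e a) v1 v2 T2 ->
  runs (While e a) v v2 (T1 + T2).+1.
Proof.
move=> h [t1 t1T H1] [t2 t2T H2]; exists (t2 + t1).+1; first by lia.
by move=> k r; rewrite iterSr /= h iterD H1 H2.
Qed.

(* The value of variable 0 is used as a stack, whose top is transformed. *)
Definition FP (f : tree -> tree) : Prop :=
  exists (c : com) (T : tree -> nat),
    [/\ forall x rest, runs c (Node x rest) (Node (f x) rest) (T x),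
        polyb T & polyb (fun x => tree_size (f x))].

Lemma FP_size f : FP f -> polyb (fun x => tree_size (f x)).
Proof. by case=> c [T []]. Qed.

Lemma FP_id : FP id.
Proof.
exists Skip, (fun=> 1); split; [|exact: polyb_const|exact: polyb_size].
by move=> x rest; exists 1.
Qed.

Lemma FP_comp f g : FP f -> FP g -> FP (fun x => f (g x)).
Proof.
move=> [c [S [Hc HS Hf]]] [d [T [Hd HT Hg]]].
exists (Seq d c), (fun x => T x + S (g x) + 1); split.
- by move=> x rest; rewrite addn1; apply: runs_seq (Hd _ _) (Hc _ _).
- apply: polyb_add (polyb_const 1); apply: polyb_add => //.
  exact: polyb_comp.
- exact: (polyb_comp Hf).
Qed.

Lemma FP_left f : FP f -> FP (fun x => left_tree (f x)).
Proof.
apply: (@FP_comp left_tree).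
exists (Assign 0 (ENode (ELeft (ELeft (EVar 0))) (ERight (EVar 0)))), (fun=> 1).
split; [|exact: polyb_const|].
  by move=> x rest; exact: runs_assign.
by apply: polyb_le polyb_size _ => -[|a b] //=; lia.
Qed.

Lemma FP_right f : FP f -> FP (fun x => right_tree (f x)).
Proof.
apply: (@FP_comp right_tree).
exists (Assign 0 (ENode (ERight (ELeft (EVar 0))) (ERight (EVar 0)))), (fun=> 1).
split; [|exact: polyb_const|].
  by move=> x rest; exact: runs_assign.
by apply: polyb_le polyb_size _ => -[|a b] //=; lia.
Qed.

Lemma FP_leaf : FP (fun=> Leaf).
Proof.
exists (Assign 0 (ENode ELeaf (ERight (EVar 0)))), (fun=> 1).
split; [|exact: polyb_const|exact: polyb_const].
by move=> x rest; exact: runs_assign.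
Qed.

Lemma FP_node f g : FP f -> FP g -> FP (fun x => Node (f x) (g x)).
Proof.
move=> [c [S [Hc HS Hf]]] [d [T [Hd HT Hg]]].
(* The stack evolves as [x]; [x, x]; [f x, x]; [x, f x]; [g x, f x]; and the two top entries are
   paired. *)
exists (Seq (Assign 0 (ENode (ELeft (EVar 0)) (EVar 0)))
  (Seq c
  (Seq (Assign 0 (ENode (ELeft (ERight (EVar 0)))
          (ENode (ELeft (EVar 0)) (ERight (ERight (EVar 0))))))
  (Seq d
    (Assign 0 (ENode (ENode (ELeft (ERight (EVar 0))) (ELeft (EVar 0)))
          (ERight (ERight (EVar 0))))))))).
exists (fun x => S x + T x + 10); split.
- move=> x rest; apply: runs_le.
    apply: runs_seq (runs_assign _ _) _ => /=.
    apply: runs_seq (Hc _ _) _.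
    apply: runs_seq (runs_assign _ _) _ => /=.
    apply: runs_seq (Hd _ _) _.
    exact: runs_assign.
  by lia.
- by apply: polyb_add (polyb_const 10); apply: polyb_add.
- apply: polyb_le (polyb_add (polyb_const 1) (polyb_add Hf Hg)) _ => x /=.
  by lia.
Qed.

Lemma FP_if c f g : FP c -> FP f -> FP g ->
  FP (fun x => if truth (c x) then f x else g x).
Proof.
move=> [a [S [Ha HS Hc]]] [b [T [Hb HT Hf]]] [d [U [Hd HU Hg]]].
exists (Seq (Assign 0 (ENode (ELeft (EVar 0)) (EVar 0)))
  (Seq a
  (If (ELeft (EVar 0)) (Seq (Assign 0 (ERight (EVar 0))) b)
                       (Seq (Assign 0 (ERight (EVar 0))) d)))).
exists (fun x => S x + (T x + U x) + 10); split.
- move=> x rest; apply: runs_le.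
    apply: runs_seq (runs_assign _ _) _ => /=.
    apply: runs_seq (Ha _ _) _.
    apply: (@runs_if _ _ _ _ _ (T x + U x + 3)) => /=; case: (truth _).
      by apply: runs_le; [apply: runs_seq (runs_assign _ _) _ => /=; exact: Hb | lia].
    by apply: runs_le; [apply: runs_seq (runs_assign _ _) _ => /=; exact: Hd | lia].
  by lia.
- by apply: polyb_add (polyb_const 10); do 2![apply: polyb_add => //].
- apply: polyb_le (polyb_add Hf Hg) _ => x /=.
  by case: truth; lia.
Qed.

(** The left part of a state holds the work still to be done, a list or a stack. *)
Definition not_halted (x : tree) : bool := truth (left_tree x).

Lemma runs_loop B c (T : tree -> nat) :
  (forall x rest, runs c (Node x rest) (Node (B x) rest) (T x)) ->
  forall n x rest M,
  (forall i, i < n -> not_halted (iter i B x)) ->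
  (forall i, i < n -> T (iter i B x) <= M) ->
  ~~ not_halted (iter n B x) ->
  runs (While (ELeft (ELeft (EVar 0))) c) (Node x rest)
    (Node (iter n B x) rest) (n * M.+1).+1.
Proof.
move=> Hc; elim=> [|n IH] x rest M H1 H2 H3.
  by rewrite mul0n; apply: runs_while_stop.
apply: (@runs_le _ _ _ (M + (n * M.+1).+1).+1); last by lia.
apply: runs_while_next; first exact: (H1 0).
  by apply: (runs_le (Hc _ _)); apply: (H2 0).
rewrite iterSr; apply: IH; rewrite -?iterSr // => i ilt; rewrite -iterSr.
  exact: H1.
exact: H2.
Qed.

(** Iterating a polynomial-time function can make trees grow exponentially, so the bound [M] on all
    intermediate states is a hypothesis. *)
Lemma FP_loop B f (N M : tree -> nat) : FP B -> FP f -> polyb N -> polyb M ->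
  (forall x i, i <= N x -> tree_size (iter i B (f x)) <= M x) ->
  (forall x i, i < N x -> not_halted (iter i B (f x))) ->
  (forall x, ~~ not_halted (iter (N x) B (f x))) ->
  FP (fun x => iter (N x) B (f x)).
Proof.
move=> [c [T [Hc [a Ha] _]]] [d [S [Hd HS _]]] HN HM H1 H2 H3.
exists (Seq d (While (ELeft (ELeft (EVar 0))) c)).
exists (fun x => S x + (N x * ((M x + 2) ^ a + 1) + 2)); split.
- move=> x rest; apply: runs_le; first apply: runs_seq (Hd x rest) _.
    apply: (@runs_loop _ _ _ Hc _ _ _ ((M x + 2) ^ a)) (H2 x) _ (H3 x) => i ilt.
    apply: leq_trans (Ha _) _; case: (a) => // a'; rewrite leq_exp2r // addn2 !ltnS.
    by apply: H1; apply: ltnW.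
  by rewrite /=; set u := _ ^ _; lia.
- apply: polyb_add => //; apply: polyb_add (polyb_const 2); apply: polyb_mul => //.
  apply: polyb_add (polyb_const 1); apply: polyb_exp.
  exact: polyb_add (polyb_const 2).
- by apply: polyb_le HM _ => x; apply: H1.
Qed.

(** * Folds, lists and unary numbers on trees *)

Fixpoint tlen (x : tree) : nat := if x is Node _ b then (tlen b).+1 else 0.

Lemma tlen_size x : tlen x < tree_size x.
Proof. by elim: x => //= a _ b; lia. Qed.

Fixpoint tfoldl (g : tree -> tree -> tree -> tree) (z l e : tree) : tree :=
  if l is Node a l' then tfoldl g (g a z e) l' e else z.

(** Each step may only add to the accumulator an amount independent of it; a multiplicative bound
    would compound along the list. *)
Definition growth (g : tree -> tree -> tree -> tree) : Prop :=
  exists2 T, polyb T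
    & forall a z e, tree_size (g a z e) <= tree_size z + T (Node a e).

Lemma FP_foldl g fz fl fe :
  growth g ->
  FP (fun x => g (left_tree x) (left_tree (right_tree x)) (right_tree (right_tree x))) ->
  FP fz -> FP fl -> FP fe -> FP (fun x => tfoldl g (fz x) (fl x) (fe x)).
Proof.
move=> [T [a Ha] HT] Hg Hz Hl He.
(* A state consists of the remaining list, the accumulator and the environment. *)
pose B (x : tree) := Node (right_tree (left_tree x))
  (Node (g (left_tree (left_tree x)) (left_tree (right_tree x)) (right_tree (right_tree x)))
        (right_tree (right_tree x))).
have HB : FP B.
  have Hll := FP_left (FP_left FP_id).
  have Hrr := FP_right (FP_right FP_id).
  have Hlr := FP_left (FP_right FP_id).
  have := FP_comp Hg (FP_node Hll (FP_node Hlr Hrr)).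
  move=> H; apply: (FP_node (FP_right (FP_left FP_id)) (FP_node H Hrr)).
have iterB i l z e : i <= tlen l -> exists l' z',
  [/\ iter i B (Node l (Node z e)) = Node l' (Node z' e),
      tlen l' + i = tlen l, tree_size l' <= tree_size l,
      tree_size z' <= tree_size z + i * (tree_size l + tree_size e).+3 ^ a
    & tfoldl g z l e = tfoldl g z' l' e].
  elim: i => [_|i IH lt]; first by exists l, z; split => //=; lia.
  have [l' [z' [E1 E2 E3 E4 E5]]] := IH (ltnW lt).
  case: l' => [|b l'] in E1 E2 E3 E5 *; first by move: E2 lt => /=; lia.
  exists l', (g b z' e); split => //=; first by rewrite E1.
  - by move: E2 => /=; lia.
  - by move: E3 => /=; lia.
  apply: leq_trans (HT _ _ _) _.
  have : T (Node b e) <= (tree_size l + tree_size e).+3 ^ a.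
    apply: leq_trans (Ha _) _; case: (a) => // a'; rewrite leq_exp2r //.
    by move: E3 => /=; lia.
  by lia.
pose st0 x := Node (fl x) (Node (fz x) (fe x)).
have Hst0 : FP st0 by do ?[apply: FP_node].
suff HF : FP (fun x => iter (tlen (fl x)) B (st0 x)).
  have -> : (fun x => tfoldl g (fz x) (fl x) (fe x)) =
            (fun x => left_tree (right_tree (iter (tlen (fl x)) B (st0 x)))).
    apply: funext => x /=.
    have [l' [z' [-> E2 _ _ ->]]] := iterB _ (fl x) (fz x) (fe x) (leqnn _).
    by case: l' E2 => //= u v; lia.
  by apply/FP_left/FP_right.
have Pl := FP_size Hl; have Pz := FP_size Hz; have Pe := FP_size He.
apply: (@FP_loop B st0 (fun x => tlen (fl x)) (fun x => tree_size (fl x) + tree_size (fz x)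
  + tree_size (fl x) * (tree_size (fl x) + tree_size (fe x) + 3) ^ a
  + tree_size (fe x) + 2)) => //.
- by apply: polyb_le Pl _ => x; apply: ltnW; apply: tlen_size.
- do ![apply: polyb_add => //; try exact: polyb_const].
  apply: polyb_mul => //; apply: polyb_exp.
  by do ![apply: polyb_add => //; try exact: polyb_const].
- move=> x i le_i.
  have [l' [z' [-> _ E3 E4 _]]] := iterB _ _ (fz x) (fe x) le_i.
  move: E4; rewrite /= addn3; set p := _ ^ a => E4.
  have : i * p <= tree_size (fl x) * p.
    by rewrite leq_mul // (leq_trans le_i) // ltnW // tlen_size.
  by lia.
- move=> x i lt; have [l' [z' [-> E2 _ _ _]]] := iterB _ _ (fz x) (fe x) (ltnW lt).
  by rewrite /not_halted /=; case: l' E2 => //=; lia.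
- move=> x; have [l' [z' [-> E2 _ _ _]]] := iterB _ (fl x) (fz x) (fe x) (leqnn _).
  by rewrite /not_halted /=; case: l' E2 => //= u v; lia.
Qed.

(** Unlike in [FP_loop] the number [n] of iterations may be exponential. The exponent [a] does not
    depend on it, as only the size of the states enters the cost of one iteration. *)
Lemma runs_search init B fin : FP init -> FP B -> FP fin ->
  exists c a, forall x n M,
    (forall i, i < n -> not_halted (iter i B (init x))) ->
    (forall i, i <= n -> tree_size (iter i B (init x)) <= M) ->
    ~~ not_halted (iter n B (init x)) ->
    runs c x (fin (iter n B (init x))) (n.+1 * (tree_size x + M).+2 ^ a).
Proof.
move=> [ci [Ti [Hci [ai Hai] _]]] [cb [Tb [Hcb [ab Hab] _]]] [cf [Tf [Hcf [af Haf] _]]].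
exists (Seq (Assign 0 (ENode (EVar 0) ELeaf))
  (Seq ci (Seq (While (ELeft (ELeft (EVar 0))) cb)
    (Seq cf (Assign 0 (ELeft (EVar 0))))))).
exists (ai + ab + af + 4) => x n M H1 H2 H3.
pose S := (tree_size x + M).+2.
have Sexp a b T y : T y <= (tree_size y).+2 ^ a -> tree_size y <= tree_size x + M ->
    a <= b -> T y <= S ^ b.
  move=> le1 le2 le3; apply: leq_trans le1 _; apply: leq_trans (leq_pexp2l _ le3) => //.
  by case: (a) => // a'; rewrite leq_exp2r.
have HM : forall i, i < n -> Tb (iter i B (init x)) <= S ^ (ai + ab + af).
  move=> i ilt; apply: Sexp (Hab _) _ _; last by lia.
  by have := H2 _ (ltnW ilt); lia.
have Hi : Ti x <= S ^ (ai + ab + af) by apply: Sexp (Hai _) _ _; lia.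
have Hf : Tf (iter n B (init x)) <= S ^ (ai + ab + af).
  by apply: Sexp (Haf _) _ _; [have := H2 _ (leqnn n); lia|lia].
apply: runs_le.
  apply: runs_seq (runs_assign _ _) _ => /=.
  apply: runs_seq (Hci _ _) _.
  apply: runs_seq (runs_loop Hcb _ H1 HM H3) _.
  apply: runs_seq (Hcf _ _) _.
  exact: runs_assign.
rewrite -/S (expnD S _ 4); set p := S ^ (_ + _) in Hi Hf HM *.
have : 16 <= S ^ 4 by apply: (@leq_trans (2 ^ 4)) => //; rewrite leq_exp2r.
have : 0 < p by rewrite expn_gt0.
set q := S ^ 4 => q16 p0.
have : n.+1 * (p * 16) <= n.+1 * (p * q) by rewrite !leq_mul.
have : n <= n * p by rewrite leq_pmulr.
rewrite /st /= mulnA mulSn (mulnS n p); move: (n * p) (n.+1 * (p * q)) Hi Hf p0 => np npq; lia.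
Qed.

Fixpoint tfoldr (g : tree -> tree -> tree -> tree) (z l e : tree) : tree :=
  if l is Node a l' then g a (tfoldr g z l' e) e else z.

Definition trev (l : tree) : tree := tfoldl (fun a z _ => Node a z) Leaf l Leaf.

(** A loop consumes a list from its head, so right folds are run as left folds over the reversed
    list. *)
Lemma tfoldr_rev g z l e : tfoldr g z l e = tfoldl g z (trev l) e.
Proof.
have H u v : tfoldl g z (tfoldl (fun a z _ => Node a z) v u Leaf) e
           = tfoldl g (tfoldr g z u e) v e.
  by elim: u v => //=.
by rewrite H.
Qed.

Lemma FP_foldr g fz fl fe :
  growth g ->
  (forall fa fz fe, FP fa -> FP fz -> FP fe -> FP (fun x => g (fa x) (fz x) (fe x))) ->
  FP fz -> FP fl -> FP fe -> FP (fun x => tfoldr g (fz x) (fl x) (fe x)).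
Proof.
move=> grow Hg Hz Hl He.
have Hlr := FP_left (FP_right FP_id); have Hrr := FP_right (FP_right FP_id).
have Hrev : FP (fun x => trev (fl x)).
  apply: FP_foldl => //; last 2 first; try exact: FP_leaf.
    exists (fun x => tree_size x) => [|a z e] /=; first exact: polyb_size.
    by lia.
  exact: FP_node (FP_left FP_id) Hlr.
have -> : (fun x => tfoldr g (fz x) (fl x) (fe x)) =
          (fun x => tfoldl g (fz x) (trev (fl x)) (fe x)).
  by apply: funext => x; rewrite tfoldr_rev.
by apply: FP_foldl => //; apply: Hg => //; apply: FP_left FP_id.
Qed.

Definition tcat (a b : tree) : tree := tfoldr (fun u z _ => Node u z) b a Leaf.

Lemma FP_cat f g : FP f -> FP g -> FP (fun x => tcat (f x) (g x)).
Proof.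
move=> Hf Hg; apply: FP_foldr => //; last exact: FP_leaf.
  exists (fun x => tree_size x) => [|a z e] /=; first exact: polyb_size.
  by lia.
by move=> *; apply: FP_node.
Qed.

Lemma size_tcat a b : tree_size (tcat a b) <= tree_size a + tree_size b.
Proof. by elim: a => //= u _ a; rewrite /tcat /= => IH; lia. Qed.

Definition tflat (h : tree -> tree -> tree) (l e : tree) : tree :=
  tfoldr (fun a z e => tcat (h a e) z) Leaf l e.

Definition FP2 (h : tree -> tree -> tree) : Prop :=
  forall f g, FP f -> FP g -> FP (fun x => h (f x) (g x)).

Lemma FP_flat h fl fe : FP2 h -> FP fl -> FP fe ->
  FP (fun x => tflat h (fl x) (fe x)).
Proof.
move=> Hh Hl He; apply: FP_foldr => //; last exact: FP_leaf.
  exists (fun x => tree_size (h (left_tree x) (right_tree x))).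
    exact: FP_size (Hh _ _ (FP_left FP_id) (FP_right FP_id)).
  by move=> a z e; apply: leq_trans (size_tcat _ _) _; rewrite addnC.
by move=> fa fz fe' Ha Hz He'; apply: FP_cat => //; apply: Hh.
Qed.

Definition tdrop (i l : tree) : tree := tfoldr (fun _ z _ => right_tree z) l i Leaf.

Lemma FP_drop f g : FP f -> FP g -> FP (fun x => tdrop (f x) (g x)).
Proof.
move=> Hf Hg; apply: FP_foldr => //; last exact: FP_leaf.
  exists (fun=> 0) => [|a z e] /=; first exact: polyb_const.
  by case: z => //= u v; lia.
by move=> fa fz fe _ Hz _; apply: FP_right.
Qed.

(** On unary numbers [tdrop] is truncated subtraction, and equality means that both differences
    vanish. *)
Definition teq (i j : tree) : tree :=
  if truth (tdrop i j) then Leaf else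
  if truth (tdrop j i) then Leaf else Node Leaf Leaf.

Lemma FP_eq f g : FP f -> FP g -> FP (fun x => teq (f x) (g x)).
Proof.
move=> Hf Hg; apply: FP_if; [exact: FP_drop|exact: FP_leaf|].
apply: FP_if; [exact: FP_drop|exact: FP_leaf|].
exact: FP_node FP_leaf FP_leaf.
Qed.

Lemma FP_const t : FP (fun=> t).
Proof. by elim: t => [|a Ha b Hb]; [exact: FP_leaf|exact: FP_node]. Qed.

Ltac fp := repeat first
  [ assumption | exact: FP_id | exact: FP_const
  | apply: FP_node | apply: FP_left | apply: FP_right | apply: FP_if
  | apply: FP_cat | apply: FP_drop | apply: FP_eq
  | apply: FP_flat; [move=> ? ? ? ?| |] ].

Lemma tcat_seq (A : Type) (enc : A -> tree) s t :
  tcat (enc_seq enc s) (enc_seq enc t) = enc_seq enc (s ++ t).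
Proof. by rewrite /tcat; elim: s => //= a s ->. Qed.

Lemma tflat_seq (A B : Type) (encA : A -> tree) (encB : B -> tree) h e
    (f : A -> seq B) s :
  (forall a, h (encA a) e = enc_seq encB (f a)) ->
  tflat h (enc_seq encA s) e = enc_seq encB (flatten (map f s)).
Proof.
by move=> H; rewrite /tflat; elim: s => //= a s ->; rewrite H tcat_seq.
Qed.

Lemma tdrop_nat i l : tdrop (enc_nat i) l = iter i right_tree l.
Proof. by rewrite /tdrop; elim: i => //= i <-. Qed.

Lemma tdrop_seq (A : Type) (enc : A -> tree) i s :
  tdrop (enc_nat i) (enc_seq enc s) = enc_seq enc (drop i s).
Proof.
rewrite tdrop_nat; elim: i s => [|i IH] s; first by rewrite drop0.
by rewrite iterSr; case: s => [|a s] /=; rewrite -?IH //; elim: i {IH} => //= i ->.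
Qed.

Lemma tdrop_natB i j : tdrop (enc_nat i) (enc_nat j) = enc_nat (j - i).
Proof.
rewrite tdrop_nat; elim: i j => [|i IH] j; first by rewrite subn0.
by rewrite iterSr; case: j => [|j]; rewrite -?IH //; elim: i {IH} => //= i ->.
Qed.

Lemma truth_nat i : truth (enc_nat i) = (0 < i).
Proof. by case: i. Qed.

Lemma teq_nat i j : teq (enc_nat i) (enc_nat j) = tree_of_bool (i == j).
Proof.
by rewrite /teq !tdrop_natB !truth_nat !subn_gt0; case: ltngtP.
Qed.

Lemma truth_seq (A : Type) (enc : A -> tree) s : truth (enc_seq enc s) = (0 < size s).
Proof. by case: s. Qed.

Lemma truth_bool b : truth (tree_of_bool b) = b.
Proof. by case: b. Qed.

(** * Cutting long paths of a laminar graph *)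

Lemma count_add3 (T : eqType) (P Q U V : pred T) s :
  {in s, forall e, P e + Q e + U e <= V e} ->
  count P s + count Q s + count U s <= count V s.
Proof.
elim: s => //= x s IH H.
have := IH (fun e es => H e (mem_behead (s := x :: s) es)).
by have := H x (mem_head _ _); lia.
Qed.

Lemma count_predU_le (T : Type) (P Q : pred T) s :
  count (predU P Q) s <= count P s + count Q s.
Proof. by rewrite -count_predUI leq_addr. Qed.

Lemma seq_max (x : nat) s :
  exists2 m, m \in x :: s & forall y, y \in x :: s -> y <= m.
Proof.
elim: s x => [|y s IH] x; first by exists x => [|y]; rewrite ?mem_head // inE => /eqP->.
have [c cJ cmax] := IH (maxn x y); exists c.
  move: cJ; rewrite !inE => /orP[/eqP->|->]; last by rewrite !orbT.
  by case: (leqP x y) => _; rewrite eqxx ?orbT.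
move=> z; rewrite !inE => /or3P[/eqP->|/eqP->|zs].
- by apply: leq_trans (leq_maxl x y) _; apply: cmax; rewrite mem_head.
- by apply: leq_trans (leq_maxr x y) _; apply: cmax; rewrite mem_head.
- by apply: cmax; rewrite inE zs orbT.
Qed.

Section Laminar.
Variable I : seq (nat * nat).
Hypothesis ltI : {in I, forall e, e.1 < e.2}.
Hypothesis laminarI : {in I &, forall e e' : nat * nat,
  ~~ [&& e.1 < e'.1, e'.1 < e.2 & e.2 < e'.2]}.

Definition within (a b : nat) : pred (nat * nat) :=
  [pred e | (a <= e.1) && (e.2 <= b)].

Definition avoid (S : pred (nat * nat)) : rel nat :=
  [rel x y | ((x, y) \in I) && ~~ S (x, y)].

Lemma avoid_sub (S S' : pred (nat * nat)) x s :
  (forall e, S e -> S' e) -> path (avoid S') x s -> path (avoid S) x s.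
Proof.
move=> SS'; apply: sub_path => u v /andP[uv NS].
by apply/andP; split=> //; apply: contra NS; apply: SS'.
Qed.

Lemma avoid_size S x s : path (avoid S) x s -> x + size s <= last x s.
Proof.
elim: s x => [|y s IH] x /=; first by rewrite addn0.
by case/andP => /andP[/ltI /= xy _] /IH; lia.
Qed.

(** Take for [c] the farthest end before [b] of an edge from [a], or [a.+1] if there is none. An
    edge over [c] that starts after [a] would cross [(a, c)]; one that starts at [a] ends at [b] by
    maximality. *)
Lemma split_point a b : a.+1 < b -> exists c, [/\ a < c, c < b &
  {in I, forall e, within a b e -> e.1 < c -> c < e.2 -> e = (a, b)}].
Proof.
move=> ab; pose J := [seq e.2 | e <- I & (e.1 == a) && (e.2 < b)].
have [c cJ cmax] : exists2 c, c \in a.+1 :: J & forall y, y \in a.+1 :: J -> y <= c.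
  exact: seq_max.
have cP : c = a.+1 \/ [/\ (a, c) \in I & c < b].
  move: cJ; rewrite inE => /orP[/eqP|/mapP[[u v]]]; first by left.
  by rewrite mem_filter /= => /andP[/andP[/eqP-> ?] ?] ->; right.
exists c; split.
- by case: cP => [->|[/ltI]].
- by case: cP => [->|[]].
move=> [x y] xyI /andP[/= ax yb] xc cy.
have [xa|xa] := eqVneq x a; last first.
  case: cP => [cE|[acI _]]; first by lia.
  by have := laminarI acI xyI; rewrite /= xc cy ltn_neqAle eq_sym xa ax.
subst x; congr pair; apply/eqP; rewrite eqn_leq yb leqNgt /=.
apply/negP => yb'; have : y <= c.
  apply: cmax; rewrite inE; apply/orP; right; apply/mapP; exists (a, y) => //.
  by rewrite mem_filter /= eqxx yb' xyI.
by lia.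
Qed.

(** Only the edge [(a, b)] jumps over [c], so any other path across stops there. *)
Lemma avoid_split S a b c x s :
  {in I, forall e, within a b e -> e.1 < c -> c < e.2 -> e = (a, b)} ->
  path (avoid S) x s -> a <= x <= c -> c <= last x s <= b ->
  (x = a /\ s = [:: b]) \/
  exists s1 s2, [/\ s = s1 ++ s2, last x s1 = c, path (avoid S) x s1
                  & path (avoid S) c s2].
Proof.
move=> Hc; elim: s x => [|y s IH] x /=.
  move=> _ ax cx; have -> : x = c by lia.
  by right; exists [::], [::].
move=> /andP[xy ys] ax cl; have [xc|xc] := eqVneq x c.
  by subst c; right; exists [::], (y :: s); split=> //=; rewrite xy.
have yl := avoid_size ys; have /andP[xyI _] := xy.
have /= xlty := ltI xyI.
have [yc|cy] := leqP y c.
  have [| |[]|[s1 [s2 [-> l1 p1 p2]]]] := IH y ys; [lia|lia|lia|].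
  by right; exists (y :: s1), s2; split => //=; rewrite xy.
have [xa yb] : (x, y) = (a, b) by apply: Hc => //=; rewrite /within /=; lia.
left; split => //; subst y.
by case: s yl cl {ys IH} => //= z s; lia.
Qed.

Variable K : nat.
Hypothesis K_gt0 : 0 < K.

(** A counter that has reached 0 starts again from [K.-1]. The shift permutes the starting values,
    so a given sibling is blocked for exactly one of them. *)
Definition pcyc (i : nat) : nat := if i is i'.+1 then i' else K.-1.

Lemma pcyc_lt i : i < K -> pcyc i < K.
Proof. by case: i => [|i] /=; lia. Qed.

Lemma sum_pcyc (f : nat -> nat) : \sum_(i < K) f (pcyc i) = \sum_(i < K) f i.
Proof.
rewrite /pcyc; case: K K_gt0 => // k _.
by rewrite big_ord_recl big_ord_recr /= addnC; congr addn.
Qed.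

(* [Cut] separates [a] from [b].  [R i] and [L j] are the edges removed when the
   counters of left and right turns start at [i] and [j]: a counter that has
   reached 0 blocks the sibling, so a path climbing to an end of the interval
   uses fewer than [K] siblings.  The term [count Cut I] in the weight bounds
   pays for blocking this interval when it becomes a sibling. *)
Record cuts (a b : nat) (Cut : pred (nat * nat)) (R L : nat -> pred (nat * nat)) : Prop := Cuts {
  cut_within : forall e, Cut e -> within a b e;
  R_within : forall i e, R i e -> within a b e;
  L_within : forall i e, L i e -> within a b e;
  cutP : forall s, path (avoid Cut) a s -> last a s <> b;
  R_weight : \sum_(i < K) count (R i) I + count Cut I <= count (within a b) I;
  L_weight : \sum_(i < K) count (L i) I + count Cut I <= count (within a b) I;
  full_size : forall i j s, i < K -> j < K -> path (avoid (predU (R i) (L j))) a s ->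
    last a s = b -> size s <= 2 ^ (i + j);
  suffix_size : forall i j x s, i < K -> j < K -> a <= x ->
    path (avoid (predU (R i) (L j))) x s -> last x s = b -> size s <= 1 + i * 4 ^ K;
  prefix_size : forall i j s, i < K -> j < K ->
    path (avoid (predU (R i) (L j))) a s -> last a s <= b -> size s <= 1 + j * 4 ^ K;
  any_size : forall i j x s, i < K -> j < K -> a <= x ->
    path (avoid (predU (R i) (L j))) x s -> last x s <= b -> size s <= 2 + 2 * K * 4 ^ K
}.

(** On leaving the left half a path still has to cross the right one, so the counter of [R] goes
    down in the left half; symmetrically that of [L] goes down in the right half. For positive [i]
    and [j] the bounds [2 ^ (i.-1 + j)] and [2 ^ (i + j.-1)] of the halves add up to [2 ^ (i + j)];
    if [i] or [j] is 0, one half is blocked and only the edge [(a, b)] gets across. *)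
Lemma cutsP a b : a < b -> exists Cut R L, cuts a b Cut R L.
Proof.
have [n] := ubnP (b - a); elim: n a b => // n IH a b ltn ab.
have [b1|ab1] := leqP b a.+1.
  have short S x s : a <= x -> path (avoid S) x s -> last x s <= b -> size s <= 1.
    by move=> ax /avoid_size; lia.
  exists (pred1 (a, b)), (fun=> pred0), (fun=> pred0); split => //.
  - by move=> _ /eqP->; rewrite /within /= !leqnn.
  - move=> [|y [|z s]] /=; first by move=> _ ?; lia.
      by move=> /andP[/andP[_ /eqP H] _] E; apply: H; rewrite E.
    by move=> /and3P[/andP[/ltI /= ? _] /andP[/ltI /= ? _] /avoid_size]; lia.
  - rewrite big1 => [|i _]; last exact: count_pred0.
    by apply: sub_count => _ /eqP->; rewrite /within /= !leqnn.
  - rewrite big1 => [|i _]; last exact: count_pred0.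
    by apply: sub_count => _ /eqP->; rewrite /within /= !leqnn.
  - move=> i j s _ _ p l; apply: leq_trans (short _ _ _ (leqnn a) p _) _; first by rewrite l.
    by rewrite expn_gt0.
  - by move=> i j x s _ _ ax p l; have := short _ _ _ ax p; rewrite l; lia.
  - by move=> i j s _ _ p l; have := short _ _ _ (leqnn a) p l; lia.
  - by move=> i j x s _ _ ax p l; have := short _ _ _ ax p l; lia.
have [c [ac cb Hc]] := split_point ab1.
have [|C1 [R1 [L1 H1]]] := IH a c _ ac; first by lia.
have [|C2 [R2 [L2 H2]]] := IH c b _ cb; first by lia.
have w1 e : within a c e -> within a b e by rewrite /within /=; lia.
have w2 e : within c b e -> within a b e by rewrite /within /=; lia.
(* Without the edge [(a, b)] every path from [a] to [b] visits [c], so it suffices to add the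
   cheaper cut of the two halves. *)
pose C : pred (nat * nat) := predU (pred1 (a, b)) (if count C1 I <= count C2 I then C1 else C2).
pose R (i : nat) : pred (nat * nat) :=
  predU (if i == 0 then C2 else pred0) (predU (R1 (pcyc i)) (R2 i)).
pose L (j : nat) : pred (nat * nat) :=
  predU (if j == 0 then C1 else pred0) (predU (L1 j) (L2 (pcyc j))).
exists C, R, L.
have wab : count (within a c) I + count (within c b) I + count (pred1 (a, b)) I
    <= count (within a b) I.
  apply: count_add3 => -[x y] /ltI /=; rewrite /within /= xpair_eqE.
  move=> xy; case: (leqP a x); case: (leqP y c); case: (leqP c x); case: (leqP y b);
    case: eqP; case: eqP => /=; lia.
have wC : count C I <= count (pred1 (a, b)) I + minn (count C1 I) (count C2 I).
  apply: leq_trans (count_predU_le _ _ _) _.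
  by rewrite leq_add2l; case: (leqP (count C1 I) (count C2 I)).
have sumK0 c0 (f g h : nat -> nat) : (forall i, f i <= (if i == 0 then c0 else 0) + (g i + h i)) ->
    \sum_(i < K) f i <= c0 + (\sum_(i < K) g i + \sum_(i < K) h i).
  move=> Hf; apply: (@leq_trans (\sum_(i < K) ((if i == 0 :> nat then c0 else 0) + (g i + h i)))).
    exact: leq_sum.
  rewrite !big_split /= leq_add2r; case: K K_gt0 => // k _.
  by rewrite big_ord_recl /= big1 // addn0.
(* The slack [c2] of one half pays for blocking it, and the slack [c1] of the other pays for the new
   cut, since [minn c1 c2 <= c1]. *)
have arith c1 c2 s1 s2 sr v1 v2 v d u : sr <= c2 + (s1 + s2) ->
    u <= d + minn c1 c2 -> v1 + v2 + d <= v -> s1 + c1 <= v1 -> s2 + c2 <= v2 ->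
    sr + u <= v by lia.
have if0 (d : bool) (P : pred (nat * nat)) :
    count (if d then P else pred0) I <= if d then count P I else 0.
  by case: d => //; rewrite count_pred0.
have subS1 i j e : predU (R1 (pcyc i)) (L1 j) e -> predU (R i) (L j) e.
  by rewrite /R /L /= => /orP[->|->]; rewrite ?orbT.
have subS2 i j e : predU (R2 i) (L2 (pcyc j)) e -> predU (R i) (L j) e.
  by rewrite /R /L /= => /orP[->|->]; rewrite ?orbT.
have no2 j s : path (avoid (predU (R 0) (L j))) c s -> last c s = b -> False.
  move=> p; apply: (cutP H2); apply: avoid_sub p => e.
  by rewrite /R /= => ->.
have no1 i s : path (avoid (predU (R i) (L 0))) a s -> last a s = c -> False.
  move=> p; apply: (cutP H1); apply: avoid_sub p => e.
  by rewrite /L /= => ->; rewrite orbT.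
have le4 i j : i < K -> j < K -> 2 ^ (i + j) <= 4 ^ K.
  by move=> iK jK; rewrite -[4]/(2 ^ 2) -expnM leq_exp2l //; lia.
split.
- move=> e /orP[/eqP->|]; first by rewrite /within /= !leqnn.
  by case: ifP => _ /cut_within H; [apply/w1/(H _ _ _ _ H1)|apply/w2/(H _ _ _ _ H2)].
- move=> i e; rewrite /R /=; case/or3P.
  + by case: ifP => // _ /(cut_within H2); apply: w2.
  + by move/(R_within H1); apply: w1.
  + by move/(R_within H2); apply: w2.
- move=> i e; rewrite /L /=; case/or3P.
  + by case: ifP => // _ /(cut_within H1); apply: w1.
  + by move/(L_within H1); apply: w1.
  + by move/(L_within H2); apply: w2.
- move=> s p l; have [| |[_ E]|[s1 [s2 [E l1 p1 p2]]]] := avoid_split Hc p; [lia|lia| |].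
    by move: p; rewrite E /= andbT /avoid /C /= eqxx andbF.
  have l2 : last c s2 = b by rewrite -l E last_cat l1.
  rewrite /C in p1 p2; case: ifP p1 p2 => _ p1 p2.
    by apply: (cutP H1) l1; apply: avoid_sub p1 => e /= ->; rewrite orbT.
  by apply: (cutP H2) l2; apply: avoid_sub p2 => e /= ->; rewrite orbT.
(* The cyclic shift of the counter in the left half is invisible in the sum over all starting
   values. *)
- have HW1 := R_weight H1; rewrite -(sum_pcyc (fun i => count (R1 i) I)) in HW1.
  have HW2 := R_weight H2; have Hsum := @sumK0 (count C2 I) (fun i => count (R i) I)
    (fun i => count (R1 (pcyc i)) I) (fun i => count (R2 i) I).
  have {}Hsum := Hsum (fun i => leq_trans (count_predU_le _ _ _)
    (leq_add (if0 _ _) (count_predU_le _ _ _))).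
  exact: arith Hsum wC wab HW1 HW2.
(* For [L] the two halves exchange their roles. *)
- have HW2 := L_weight H2; rewrite -(sum_pcyc (fun i => count (L2 i) I)) in HW2.
  have HW1 := L_weight H1; have Hsum := @sumK0 (count C1 I) (fun i => count (L i) I)
    (fun i => count (L1 i) I) (fun i => count (L2 (pcyc i)) I).
  have {}Hsum := Hsum (fun i => leq_trans (count_predU_le _ _ _)
    (leq_add (if0 _ _) (count_predU_le _ _ _))).
  rewrite minnC in wC; rewrite [X in _ <= _ + X]addnC in Hsum.
  by rewrite [X in X + _ <= _]addnC in wab; exact: arith Hsum wC wab HW2 HW1.
- move=> i j s iK jK p l.
  have [| |[_ ->]|[s1 [s2 [E l1 p1 p2]]]] := avoid_split Hc p; [lia|lia| |].
    by rewrite expn_gt0.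
  have l2 : last c s2 = b by rewrite -l E last_cat l1.
  (* At counter 0 a half that has to be crossed completely is blocked by its cut. *)
  case: i iK p p1 p2 => [|i] iK p p1 p2; first by case: (no2 _ _ p2).
  case: j jK p p1 p2 => [|j] jK p p1 p2; first by case: (no1 _ _ p1).
  have := full_size H1 (pcyc_lt iK) jK (avoid_sub (@subS1 _ _) p1) l1.
  have := full_size H2 iK (pcyc_lt jK) (avoid_sub (@subS2 _ _) p2) l2.
  rewrite E size_cat /= !addSn !addnS !expnS; move: (2 ^ (i + j)) => p0.
  by lia.
- move=> i j x s iK jK ax p l.
  have [cx|xc] := leqP c x.
    exact: (suffix_size H2 iK (pcyc_lt jK) cx (avoid_sub (@subS2 _ _) p) l).
  have [| |[_ ->]|[s1 [s2 [E l1 p1 p2]]]] := avoid_split Hc p; [lia|lia| |].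
    by rewrite /=; lia.
  have l2 : last c s2 = b by rewrite -l E last_cat l1.
  case: i iK p p1 p2 => [|i] iK p p1 p2; first by case: (no2 _ _ p2).
  have := suffix_size H1 (pcyc_lt iK) jK ax (avoid_sub (@subS1 _ _) p1) l1.
  have := full_size H2 iK (pcyc_lt jK) (avoid_sub (@subS2 _ _) p2) l2.
  have := le4 _ _ iK (pcyc_lt jK).
  by rewrite E size_cat /= mulSn; lia.
- move=> i j s iK jK p l.
  have [lc|cl] := leqP (last a s) c.
    exact: (prefix_size H1 (pcyc_lt iK) jK (avoid_sub (@subS1 _ _) p) lc).
  have [| |[_ ->]|[s1 [s2 [E l1 p1 p2]]]] := avoid_split Hc p; [lia|lia| |].
    by rewrite /=; lia.
  have l2 : last c s2 <= b by move: l; rewrite E last_cat l1.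
  case: j jK p p1 p2 => [|j] jK p p1 p2; first by case: (no1 _ _ p1).
  have := full_size H1 (pcyc_lt iK) jK (avoid_sub (@subS1 _ _) p1) l1.
  have := prefix_size H2 iK (pcyc_lt jK) (avoid_sub (@subS2 _ _) p2) l2.
  have := le4 _ _ (pcyc_lt iK) jK.
  by rewrite E size_cat /= mulSn; lia.
- move=> i j x s iK jK ax p l.
  have [lc|cl] := leqP (last x s) c.
    exact: (any_size H1 (pcyc_lt iK) jK ax (avoid_sub (@subS1 _ _) p) lc).
  have [cx|xc] := leqP c x.
    exact: (any_size H2 iK (pcyc_lt jK) cx (avoid_sub (@subS2 _ _) p) l).
  have [| |[_ ->]|[s1 [s2 [E l1 p1 p2]]]] := avoid_split Hc p; [lia|lia| |].
    by rewrite /=; lia.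
  have l2 : last c s2 <= b by move: l; rewrite E last_cat l1.
  have := suffix_size H1 (pcyc_lt iK) jK ax (avoid_sub (@subS1 _ _) p1) l1.
  have := prefix_size H2 iK (pcyc_lt jK) (avoid_sub (@subS2 _ _) p2) l2.
  have := pcyc_lt iK; have := pcyc_lt jK; rewrite E size_cat.
  move: (pcyc i) (pcyc j) (4 ^ K) => u v w uK vK.
  have : u * w <= K * w by rewrite leq_mul // ltnW.
  have : v * w <= K * w by rewrite leq_mul // ltnW.
  by rewrite -mulnA; lia.
Qed.

(** The starting values of the two counters are chosen independently by averaging; each family then
    removes at most [size I / K] edges. *)
Lemma laminar_cut : exists S : pred (nat * nat),
  K * count S I <= 2 * size I
  /\ forall x s, path (avoid S) x s -> size s <= 2 + 2 * K * 4 ^ K.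
Proof.
(* The additional 1 keeps the interval from 0 to [b] nonempty when there are no edges. *)
have [b _ bmax] := seq_max 1 (map snd I).
have [|C [R [L H]]] := @cutsP 0 b; first by apply: bmax; rewrite mem_head.
have avg (f : nat -> nat) m : \sum_(i < K) f i <= m -> exists2 i, i < K & K * f i <= m.
  move=> le; case: (boolP [exists i : 'I_K, K * f i <= m]) => [/existsP[i ?]|].
    by exists i.
  move=> /existsPn H'; suff : K * m < K * m by rewrite ltnn.
  have : \sum_(i < K) m.+1 <= \sum_(i < K) (K * f i).
    by apply: leq_sum => i _; rewrite ltnNge H'.
  rewrite sum_nat_const card_ord -big_distrr /=.
  by move/leq_trans/(_ (leq_mul (leqnn K) le)); rewrite leq_pmul2l // ltnn.
have [i iK Hi] : exists2 i, i < K & K * count (R i) I <= size I.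
  exact/avg/(leq_trans (leq_trans (leq_addr _ _) (R_weight H)))/count_size.
have [j jK Hj] : exists2 j, j < K & K * count (L j) I <= size I.
  exact/avg/(leq_trans (leq_trans (leq_addr _ _) (L_weight H)))/count_size.
exists (predU (R i) (L j)); split.
  apply: (@leq_trans (K * (count (R i) I + count (L j) I))).
    by rewrite leq_mul // count_predU_le.
  by rewrite mulnDr mul2n -addnn leq_add.
move=> x s p; have [->//|s0] := eqVneq (size s) 0.
apply: (any_size H iK jK (leq0n x) p); apply: bmax.
rewrite inE; apply/orP; right.
case/lastP: s p s0 => // s y; rewrite rcons_path last_rcons => /andP[_ /andP[yI _]] _.
by apply/mapP; exists (last x s, y).
Qed.
End Laminar.

(** * Clauses for a circuit some of whose vertices are variables *)

Definition literal := (bool * nat)%type.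
Definition holds (y : nat -> bool) (cl : seq literal) : bool := has (fun l => y l.2 == l.1) cl.
Definition sat (y : nat -> bool) (cls : seq (seq literal)) : bool := all (holds y) cls.

(** Distributivity, written with singletons under [flatten] so that [tflat_seq] applies to its
    encoding. *)
Definition disj (s t : seq (seq literal)) : seq (seq literal) :=
  flatten (map (fun c1 => flatten (map (fun c2 => [:: c1 ++ c2]) t)) s).

Lemma sat_cat y s t : sat y (s ++ t) = sat y s && sat y t.
Proof. exact: all_cat. Qed.

Lemma sat_flatten (A : Type) y (f : A -> seq (seq literal)) s :
  sat y (flatten (map f s)) = all (fun a => sat y (f a)) s.
Proof. by elim: s => //= a s IH; rewrite sat_cat IH. Qed.

Lemma sat_disj y s t : sat y (disj s t) = sat y s || sat y t.
Proof.
rewrite sat_flatten; elim: s => //= c1 s ->; rewrite sat_flatten.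
have -> : all (fun c2 => sat y [:: c1 ++ c2]) t = holds y c1 || sat y t.
  elim: t => [|c2 t] /=; first by rewrite orbT.
  by move=> ->; rewrite /= andbT /holds has_cat; do 2!case: has.
by case: (holds _ _) => //=; case: (sat y t); rewrite ?orbT ?andbT.
Qed.

Section Expansion.
Variable C : circuit.
Local Notation vertex := 'I_(Defs.order (dag C)).

(* [names] lists for every vertex the variable which stands for it, if any. *)
Variable names : seq (option nat).
Definition name (v : vertex) : option nat := nth None names v.

Definition child (A : Type) (f : vertex -> A) (a : A) (i : bool) (v : vertex) : A :=
  if drop i (preds v) is u :: _ then f u else a.

Lemma gate_valueE (val : vertex -> bool) v :
  gate_value val v = gate C v (child val false false v, child val false true v).
Proof. by rewrite /gate_value /child; case: (preds v) => [|u [|w s]]. Qed.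

(** Within [d] levels every branch of the unfolding of [v] meets a named vertex or ends at a missing
    argument, which is constant. *)
Fixpoint ok (d : nat) (v : vertex) : bool :=
  (name v != None) ||
  (if d is d'.+1 then child (ok d') true false v && child (ok d') true true v else false).

Definition ok_children d v := child (ok d) true false v && child (ok d) true true v.

Section Value.
Variable y : nat -> bool.

Fixpoint expand (d : nat) (v : vertex) : bool :=
  if name v is Some r then y r else
  if d is d'.+1 then
    gate C v (child (expand d') false false v, child (expand d') false true v)
  else false.
End Value.

(* The clauses saying that the [i]-th argument of [v] does not have value [a],
   where [f] gives the clauses for a vertex; a missing argument is false. *)
Definition arg_clauses (f : bool -> vertex -> seq (seq literal)) (a i : bool) (v : vertex) :=
  child (f a) (if a then [::] else [:: [::]]) i v.

Definition case_clauses f (b a0 a1 : bool) v :=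
  if gate C v (a0, a1) == b
  then disj (arg_clauses f a0 false v) (arg_clauses f a1 true v) else [::].

Definition gate_clauses f (b : bool) v :=
  case_clauses f b false false v ++ case_clauses f b false true v ++
  case_clauses f b true false v ++ case_clauses f b true true v.

(** Disequations are expressed because a gate differs from [b] iff every row of its table with value
    [b] is missed by one of the arguments. This is a conjunction of disjunctions, and each level at
    most doubles the width. *)
Fixpoint neq_clauses (d : nat) (b : bool) (v : vertex) : seq (seq literal) :=
  if name v is Some r then [:: [:: (~~ b, r)]] else
  if d is d'.+1 then gate_clauses (neq_clauses d') b v else [::].

(** Two implications: if the gate has value [b], then so has the variable [r]. *)
Definition def_clauses d (v : vertex) : seq (seq literal) :=
  if name v is Some r then
    flatten (map (fun c => [:: (true, r) :: c]) (gate_clauses (neq_clauses d) true v)) ++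
    flatten (map (fun c => [:: (false, r) :: c]) (gate_clauses (neq_clauses d) false v))
  else [::].

(** The heads of the wires are exactly the gates, perhaps repeated. The output may lie one level
    above vertices that are [ok] at depth [d], whence [d.+1]. *)
Definition circuit_clauses d : seq (seq literal) :=
  neq_clauses d.+1 false (out C) ++ flatten (map (fun e => def_clauses d e.2) (edges (dag C))).

Lemma sat_gate y d b v :
  (forall u, ok d u -> forall a, sat y (neq_clauses d a u) = (expand y d u != a)) ->
  ok_children d v ->
  sat y (gate_clauses (neq_clauses d) b v) =
    (gate C v (child (expand y d) false false v, child (expand y d) false true v) != b).
Proof.
move=> IH /andP[ok0 ok1].
have argP i a : child (ok d) true i v ->
    sat y (arg_clauses (neq_clauses d) a i v) = (child (expand y d) false i v != a).
  by rewrite /arg_clauses /child; case: drop => [_|u s /IH/(_ a)//]; case: a.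
have caseP a0 a1 : sat y (case_clauses (neq_clauses d) b a0 a1 v) =
    (gate C v (a0, a1) == b) ==>
    ((child (expand y d) false false v != a0) || (child (expand y d) false true v != a1)).
  by rewrite /case_clauses; case: ifP => // _; rewrite sat_disj !argP.
rewrite /gate_clauses !sat_cat !caseP.
by case: (child _ _ false _); case: (child _ _ true _); case: b {caseP};
  do 4!case: (gate C v _).
Qed.

Lemma sat_neq y d v : ok d v -> forall b, sat y (neq_clauses d b v) = (expand y d v != b).
Proof.
elim: d v => [|d IH] v /= okv b.
  by move: okv; case: name => //= r _; rewrite orbF andbT; case: (y r); case: b.
move: okv; case: name => [r _|/=]; last exact: sat_gate.
by rewrite /= orbF andbT; case: (y r); case: b.
Qed.

Lemma gate_clauses_all (P : pred literal) (w : nat) f b v :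
  (forall a u, all (fun c => all P c && (size c <= w)) (f a u)) ->
  all (fun c => all P c && (size c <= w + w)) (gate_clauses f b v).
Proof.
move=> H.
have argP a i : all (fun c => all P c && (size c <= w)) (arg_clauses f a i v).
  by rewrite /arg_clauses /child; case: drop => // ; case: a.
have disjP s t : all (fun c => all P c && (size c <= w)) s ->
    all (fun c => all P c && (size c <= w)) t ->
    all (fun c => all P c && (size c <= w + w)) (disj s t).
  move=> Hs Ht; apply/allP => c /flattenP[_ /mapP[c1 /(allP Hs)/andP[P1 s1] ->]].
  move=> /flattenP[_ /mapP[c2 /(allP Ht)/andP[P2 s2] ->]]; rewrite inE => /eqP->.
  by rewrite all_cat P1 P2 size_cat leq_add.
by rewrite /gate_clauses !all_cat /case_clauses; do 4!case: ifP => _; rewrite ?disjP.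
Qed.

Lemma neq_clauses_all (P : pred literal) d b v :
  (forall v r b, name v = Some r -> P (b, r)) ->
  all (fun c => all P c && (size c <= 2 ^ d)) (neq_clauses d b v).
Proof.
move=> HP; elim: d b v => [|d IH] b v /=; case E: (name v) => [r|] //=.
- by rewrite (HP _ _ _ E).
- by rewrite (HP _ _ _ E) /= expn_gt0.
- by rewrite expnS mul2n -addnn; apply: gate_clauses_all.
Qed.

Lemma circuit_clauses_all (P : pred literal) d :
  (forall v r b, name v = Some r -> P (b, r)) ->
  all (fun c => all P c && (size c <= (2 ^ d.+1).+1)) (circuit_clauses d).
Proof.
move=> HP; rewrite /circuit_clauses all_cat; apply/andP; split.
  apply: sub_all (neq_clauses_all d.+1 false (out C) HP) => c /andP[-> /= H].
  exact: leqW.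
apply/allP => c /flattenP[_ /mapP[e _ ->]]; rewrite /def_clauses.
case E: name => [r|] //; rewrite mem_cat.
have H b : c \in flatten (map (fun c => [:: (b, r) :: c]) (gate_clauses (neq_clauses d) b e.2)) ->
    all P c && (size c <= (2 ^ d.+1).+1).
  move=> /flattenP[_ /mapP[c' c'P ->]]; rewrite inE => /eqP->.
  have := allP (@gate_clauses_all P (2 ^ d) _ b e.2 (fun a u => neq_clauses_all d a u HP)) _ c'P.
  by rewrite /= (HP _ _ _ E) ltnS expnS mul2n -addnn.
by case/orP => /H.
Qed.

Lemma not_input_edge v : ~~ is_input v -> exists2 e, e \in edges (dag C) & e.2 = v.
Proof.
rewrite /is_input -lt0n /preds size_map size_filter -has_count => /hasP[e eE /eqP].
by exists e.
Qed.

Lemma child_ok d (i : bool) v u s : ok_children d v -> drop i (preds v) = u :: s -> ok d u.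
Proof.
by case/andP; rewrite /child; case: i => H1 H2 E; [rewrite E in H2|rewrite E in H1].
Qed.

Lemma child_ok_in (A : Type) d (f g : vertex -> A) a i v : ok_children d v ->
  (forall u, adj u v -> ok d u -> f u = g u) -> child f a i v = child g a i v.
Proof.
move=> okv H; rewrite /child; case E: drop => [//|u s]; apply: H (child_ok okv E).
have : u \in drop i (preds v) by rewrite E mem_head.
by move/mem_drop => /mapP[[u' v'] ]; rewrite mem_filter /= => /andP[/eqP-> ?] ->.
Qed.

(** Given inputs, each variable takes the value of the vertex it names. Conversely the inputs are
    read off [y], and the defining clauses force every named gate to its true value. *)
Lemma circuit_satP d (l : vertex -> nat) : acyclic (dag C) -> labeling l ->
  (forall v, is_input v -> name v != None) ->
  (forall u v r, name u = Some r -> name v = Some r -> u = v) ->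
  (forall e, e \in edges (dag C) -> ok_children d e.2) ->
  circuit_sat C <-> exists y, sat y (circuit_clauses d).
Proof.
move=> acy lab inp inj okE.
have okS v : ok d.+1 v.
  rewrite /=; case: (boolP (is_input v)) => [/inp->//|/not_input_edge[e /okE H <-]].
  by apply/orP; right.
have lt_adj u v : adj u v -> l u < l v by move=> /lab.
have sat_def y : sat y (flatten (map (fun e => def_clauses d e.2) (edges (dag C)))) <->
    forall v r, ~~ is_input v -> name v = Some r ->
    y r = gate C v (child (expand y d) false false v, child (expand y d) false true v).
  rewrite sat_flatten.
  have satr b e r : ok_children d e.2 ->
      sat y (flatten (map (fun c => [:: (b, r) :: c]) (gate_clauses (neq_clauses d) b e.2))) =
      (y r == b) || (gate C e.2 (child (expand y d) false false e.2,
                                 child (expand y d) false true e.2) != b).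
    move=> oke; rewrite -sat_gate //; last by move=> u /sat_neq.
    rewrite sat_flatten /sat; elim: (gate_clauses _ _ _) => [|c s /= ->]; first by rewrite orbT.
    by rewrite /= andbT; case: (y r == b).
  split=> [H v r nv vr|H].
    have [e eE ev] := not_input_edge nv; have := allP H _ eE.
    rewrite /def_clauses ev vr sat_cat -ev !satr ?okE //.
    by case: (y r); case: (gate C _ _).
  apply/allP => e eE; rewrite /def_clauses; case E: name => [r|] //.
  have ne : ~~ is_input e.2.
    rewrite /is_input /preds size_map size_filter -lt0n -has_count.
    by apply/hasP; exists e => /=.
  by rewrite sat_cat !satr ?okE // -(H _ _ ne E); case: (y r).
have inputE (x : {ffun {v : vertex | is_input v} -> bool}) v (vi : is_input v) :
    eval_circuit x v = x (Sub v vi).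
  rewrite eval_circuitE //.
  case: (insubP {v : vertex | is_input v} v) => [u _ uv|]; last by rewrite vi.
  by congr (x _); apply: val_inj; rewrite SubK.
have gateE (x : {ffun {v : vertex | is_input v} -> bool}) v : ~~ is_input v -> eval_circuit x v =
    gate C v (child (eval_circuit x) false false v, child (eval_circuit x) false true v).
  move=> nv; rewrite eval_circuitE //.
  case: (insubP {v : vertex | is_input v} v) => [u vi|_]; last exact: gate_valueE.
  by rewrite vi in nv.
split.
  move=> /existsP[x xout].
  (* A name belongs to one vertex only, so the existential speaks of that vertex. *)
  pose y r := [exists v, (name v == Some r) && eval_circuit x v].
  have yE v r : name v = Some r -> y r = eval_circuit x v.
    move=> vr; apply/existsP/idP => [[u]|ev].
      by case/andP => /eqP ur; rewrite (inj u v r).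
    by exists v; rewrite vr eqxx.
  have expE d' v : ok d' v -> expand y d' v = eval_circuit x v.
    elim: d' v => [|d' IH] v /=; case E: name => [r|] //= okv; try exact: yE.
    have nv : ~~ is_input v by apply/negP => /inp; rewrite E.
    rewrite gateE //; congr (gate C v (_, _)); apply: child_ok_in okv _ => u _; exact: IH.
  exists y; rewrite sat_cat; apply/andP; split.
    by rewrite sat_neq // expE // xout.
  apply/sat_def => v r nv vr; rewrite (yE _ _ vr) gateE //.
  have [e /okE oke ev] := not_input_edge nv; rewrite ev in oke.
  congr (gate C v (_, _)); apply: child_ok_in oke _ => u _; by move/expE.
move=> [y]; rewrite sat_cat => /andP[yout /sat_def ydef].
pose x := [ffun v : {v : vertex | is_input v} => y (odflt 0 (name (val v)))].
have expE v : forall d', ok d' v -> expand y d' v = eval_circuit x v.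
  (* Induction on the depth would fail: a named gate takes its value from its own defining clauses,
     at full depth again. Labels do go down from a gate to its arguments. *)
  have [n] := ubnP (l v); elim: n v => // n IH v; rewrite ltnS => vn d' okv.
  have {}IH u d'' : adj u v -> ok d'' u -> expand y d'' u = eval_circuit x u.
    by move=> /lt_adj uv; apply: IH; apply: leq_trans uv vn.
  have [vi|nv] := boolP (is_input v).
    rewrite inputE ffunE /=; move: (inp v vi).
    by case: d' okv => [|d'] /=; case: name.
  rewrite gateE //.
  have named r : name v = Some r -> y r = gate C v
      (child (eval_circuit x) false false v, child (eval_circuit x) false true v).
    move=> vr; rewrite (ydef v r) //.
    have [e /okE oke ev] := not_input_edge nv; rewrite ev in oke.
    by congr (gate C v (_, _)); apply: child_ok_in oke _ => u uv; apply: IH.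
  case: d' okv => [|d'] /=; case E: name => [r|] //= okv; try exact: named.
  by congr (gate C v (_, _)); apply: child_ok_in okv _ => u uv; apply: IH.
apply/existsP; exists x; rewrite -(expE _ d.+1) //.
by move: yout; rewrite sat_neq //; case: expand.
Qed.
End Expansion.

(* In the tree functions below, [env] holds the names of the vertices, the
   edges and the gates of a circuit. *)
Definition tname (v env : tree) : tree := left_tree (tdrop v (left_tree env)).

Definition tpreds (v edges : tree) : tree :=
  tflat (fun e v => if truth (teq (right_tree e) v) then Node (left_tree e) Leaf else Leaf)
    edges v.

Definition tkid (i : bool) (v env : tree) : tree :=
  let p := tpreds v (left_tree (right_tree env)) in if i then right_tree p else p.

Definition tchild (f : tree -> tree -> tree) (d : tree) i v env : tree :=
  if truth (tkid i v env) then f (left_tree (tkid i v env)) env else d.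

Fixpoint tok (d : nat) (v env : tree) : tree :=
  if truth (tname v env) then tree_of_bool true else
  if d is d'.+1 then
    if truth (tchild (tok d') (tree_of_bool true) false v env) then
      tchild (tok d') (tree_of_bool true) true v env
    else Leaf
  else Leaf.

Definition tok_children (d : nat) (v env : tree) : tree :=
  if truth (tchild (tok d) (tree_of_bool true) false v env) then
    tchild (tok d) (tree_of_bool true) true v env
  else Leaf.

Definition tdisj (s t : tree) : tree :=
  tflat (fun c1 t => tflat (fun c2 c1 => Node (tcat c1 c2) Leaf) t c1) s t.

Definition targ (f : bool -> tree -> tree -> tree) (a i : bool) (v env : tree) : tree :=
  tchild (f a) (if a then Leaf else Node Leaf Leaf) i v env.

(** [enc_circuit] lists the rows of a truth table in the order 00, 01, 10, 11. *)
Definition tgate (a0 a1 : bool) (v env : tree) : tree :=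
  left_tree (iter (a0.*2 + a1) right_tree
    (left_tree (tdrop v (right_tree (right_tree env))))).

Definition tcase f (b a0 a1 : bool) (v env : tree) : tree :=
  if truth (tgate a0 a1 v env) then
    (if b then tdisj (targ f a0 false v env) (targ f a1 true v env) else Leaf)
  else
    (if b then Leaf else tdisj (targ f a0 false v env) (targ f a1 true v env)).

Definition tgate_clauses f (b : bool) (v env : tree) : tree :=
  tcat (tcase f b false false v env) (tcat (tcase f b false true v env)
  (tcat (tcase f b true false v env) (tcase f b true true v env))).

Fixpoint tneq (d : nat) (b : bool) (v env : tree) : tree :=
  if truth (tname v env) then
    Node (Node (Node (tree_of_bool (~~ b)) (left_tree (tname v env))) Leaf) Leaf
  else if d is d'.+1 then tgate_clauses (tneq d') b v env else Leaf.

Definition tprefix (b : bool) (r cls : tree) : tree :=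
  tflat (fun c r => Node (Node (Node (tree_of_bool b) r) c) Leaf) cls r.

Definition tdef (d : nat) (v env : tree) : tree :=
  if truth (tname v env) then
    tcat (tprefix true (left_tree (tname v env)) (tgate_clauses (tneq d) true v env))
         (tprefix false (left_tree (tname v env)) (tgate_clauses (tneq d) false v env))
  else Leaf.

Definition tclauses (d : nat) (o env : tree) : tree :=
  tcat (tneq d.+1 false o env)
    (tflat (fun e env => tdef d (right_tree e) env) (left_tree (right_tree env)) env).

Definition tbad (d : nat) (env : tree) : tree :=
  tflat (fun e env => if truth (tok_children d (right_tree e) env) then Leaf else tree_of_bool true)
    (left_tree (right_tree env)) env.

(** * The clause construction takes polynomial time *)

Lemma FP2_name : FP2 tname.
Proof. by move=> f g Hf Hg; rewrite /tname; fp. Qed.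

Lemma FP_preds f g : FP f -> FP g -> FP (fun x => tpreds (f x) (g x)).
Proof. by move=> Hf Hg; rewrite /tpreds; fp. Qed.

Lemma FP2_kid i : FP2 (tkid i).
Proof.
move=> f g Hf Hg; rewrite /tkid /=.
by case: i; do ?apply: FP_right; apply: FP_preds; fp.
Qed.

Lemma FP2_child h d i : FP2 h -> FP2 (tchild h d i).
Proof.
move=> Hh f g Hf Hg; rewrite /tchild; have H := FP2_kid i Hf Hg.
by apply: FP_if => //; [apply: Hh; fp|fp].
Qed.

Lemma FP2_ok_children d : FP2 (tok d) -> FP2 (tok_children d).
Proof.
by move=> H f g Hf Hg; apply: FP_if; [apply: FP2_child|apply: FP2_child|fp].
Qed.

Lemma FP2_ok d : FP2 (tok d).
Proof.
elim: d => [|d IH] f g Hf Hg /=.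
  by apply: FP_if; [apply: FP2_name|fp|fp].
apply: FP_if; [by apply: FP2_name|by fp|].
exact: FP2_ok_children.
Qed.

Lemma FP2_disj : FP2 tdisj.
Proof. by move=> f g Hf Hg; rewrite /tdisj; fp. Qed.

Lemma FP2_gate a0 a1 : FP2 (tgate a0 a1).
Proof.
by move=> f g Hf Hg; rewrite /tgate; case: a0; case: a1; rewrite /=; fp.
Qed.

Lemma FP2_gate_clauses h b : (forall a, FP2 (h a)) -> FP2 (tgate_clauses h b).
Proof.
move=> Hh.
have Hcase a0 a1 : FP2 (tcase h b a0 a1).
  move=> f g Hf Hg; rewrite /tcase.
  have H : FP (fun x => tdisj (targ h a0 false (f x) (g x)) (targ h a1 true (f x) (g x))).
    by apply: FP2_disj; apply: FP2_child.
  by apply: FP_if; [apply: FP2_gate|case: b|case: b]; fp.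
by move=> f g Hf Hg; do !apply: FP_cat; apply: Hcase.
Qed.

Lemma FP2_neq d b : FP2 (tneq d b).
Proof.
elim: d b => [|d IH] b f g Hf Hg /=; have H := FP2_name Hf Hg.
  by apply: FP_if; fp.
by apply: FP_if => //; [fp|exact: FP2_gate_clauses].
Qed.

Lemma FP_prefix b f g : FP f -> FP g -> FP (fun x => tprefix b (f x) (g x)).
Proof. by move=> Hf Hg; rewrite /tprefix; fp. Qed.

Lemma FP2_def d : FP2 (tdef d).
Proof.
move=> f g Hf Hg; have H := FP2_name Hf Hg; rewrite /tdef.
have Hc b : FP2 (tgate_clauses (tneq d) b).
  by apply: FP2_gate_clauses => a; apply: FP2_neq.
by apply: FP_if; [|apply: FP_cat; apply: FP_prefix; [fp|apply: Hc|fp|apply: Hc]|fp].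
Qed.

Lemma FP2_clauses d : FP2 (tclauses d).
Proof.
move=> f g Hf Hg; apply: FP_cat; first exact: (@FP2_neq d.+1 false).
by apply: FP_flat => [u v Hu Hv||]; [apply: FP2_def; fp|fp|fp].
Qed.

Lemma FP_bad d f : FP f -> FP (fun x => tbad d (f x)).
Proof.
move=> Hf; apply: FP_flat => [u v Hu Hv||]; [|fp|fp].
by apply: FP_if; [apply: FP2_ok_children; [exact: FP2_ok|fp|fp]|fp|fp].
Qed.

(** * The tree functions compute the encoded clauses *)

Definition enc_option (o : option nat) : tree :=
  if o is Some r then Node (enc_nat r) Leaf else Leaf.
Definition enc_literal (l : literal) : tree := Node (tree_of_bool l.1) (enc_nat l.2).
Definition enc_clauses : seq (seq literal) -> tree := enc_seq (enc_seq enc_literal).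

Section Encoding.
Variables (C : circuit) (names : seq (option nat)).
Local Notation vertex := 'I_(Defs.order (dag C)).

Definition enc_vertex (v : vertex) : tree := enc_nat v.
Definition enc_edges : tree :=
  enc_seq (fun e : vertex * vertex => Node (enc_nat e.1) (enc_nat e.2)) (edges (dag C)).
Definition enc_gates : tree :=
  enc_seq (fun v : vertex => enc_seq (fun ab => tree_of_bool (gate C v ab))
    [:: (false, false); (false, true); (true, false); (true, true)])
    (enum 'I_(Defs.order (dag C))).
Definition enc_env : tree := Node (enc_seq enc_option names) (Node enc_edges enc_gates).

Lemma tnameE (v : vertex) : tname (enc_nat v) enc_env = enc_option (name names v).
Proof.
rewrite /tname tdrop_seq /name; case: (ltnP v (size names)) => [lt|ge].
  by rewrite (drop_nth None).
by rewrite drop_oversize // nth_default.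
Qed.

Lemma truth_option o : truth (enc_option o) = (o != None).
Proof. by case: o. Qed.

Lemma tpredsE (v : vertex) : tpreds (enc_nat v) enc_edges = enc_seq enc_vertex (preds v).
Proof.
rewrite /tpreds (tflat_seq (encB := enc_vertex)
  (f := fun e => if e.2 == v then [:: e.1] else [::])).
  by congr enc_seq; rewrite /preds; elim: edges => //= e s ->; case: (_ == _).
by move=> e /=; rewrite teq_nat truth_bool -val_eqE; case: (_ == _).
Qed.

Lemma tkidE i (v : vertex) : tkid i (enc_nat v) enc_env = enc_seq enc_vertex (drop i (preds v)).
Proof.
by rewrite /tkid /= tpredsE; case: i; case: (preds v) => //= u s; rewrite drop0.
Qed.

Lemma tchildE (A : Type) (enc : A -> tree) h t f a i (v : vertex) :
  (forall u : vertex, h (enc_nat u) enc_env = enc (f u)) -> t = enc a ->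
  tchild h t i (enc_nat v) enc_env = enc (child f a i v).
Proof.
by move=> H1 H2; rewrite /tchild tkidE /child; case: drop => //= u s; rewrite H1.
Qed.

Lemma tokE d (v : vertex) : tok d (enc_nat v) enc_env = tree_of_bool (ok names d v).
Proof.
elim: d v => [|d IH] v /=; rewrite tnameE truth_option; case: eqP => //= _.
rewrite !(tchildE (enc := tree_of_bool) (f := ok names d) (a := true)) //.
by rewrite truth_bool; case: (child _ _ _ _).
Qed.

Lemma tok_childrenE d (v : vertex) :
  tok_children d (enc_nat v) enc_env = tree_of_bool (ok_children names d v).
Proof.
rewrite /tok_children !(tchildE (enc := tree_of_bool) (f := ok names d) (a := true)) //;
  try exact: tokE.
by rewrite truth_bool /ok_children; case: (child _ _ _ _).
Qed.

Lemma tbadE d : truth (tbad d enc_env) =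
  ~~ all (fun e => ok_children names d e.2) (edges (dag C)).
Proof.
rewrite /tbad (tflat_seq (encB := fun _ : unit => Leaf)
  (f := fun e => if ok_children names d e.2 then [::] else [:: tt])).
  by rewrite truth_seq; elim: edges => //= e s IH; case: (ok_children _ _ _).
by move=> e /=; rewrite tok_childrenE truth_bool; case: (ok_children _ _ _).
Qed.

Lemma tdisjE s t : tdisj (enc_clauses s) (enc_clauses t) = enc_clauses (disj s t).
Proof.
apply: tflat_seq => c1; apply: tflat_seq => c2; by rewrite tcat_seq.
Qed.

Lemma tgateE a0 a1 (v : vertex) :
  tgate a0 a1 (enc_nat v) enc_env = tree_of_bool (gate C v (a0, a1)).
Proof.
rewrite /tgate /= tdrop_seq (drop_nth v) ?size_enum_ord // nth_ord_enum /=.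
by case: a0; case: a1.
Qed.

Lemma tgate_clausesE h f b (v : vertex) :
  (forall a (u : vertex), h a (enc_nat u) enc_env = enc_clauses (f a u)) ->
  tgate_clauses h b (enc_nat v) enc_env = enc_clauses (gate_clauses f b v).
Proof.
move=> H.
have argE a i : targ h a i (enc_nat v) enc_env = enc_clauses (arg_clauses f a i v).
  by apply: tchildE => //; case: a.
have caseE a0 a1 : tcase h b a0 a1 (enc_nat v) enc_env = enc_clauses (case_clauses f b a0 a1 v).
  rewrite /tcase tgateE truth_bool !argE tdisjE /case_clauses.
  by case: (gate C v _); case: b.
by rewrite /tgate_clauses !caseE !tcat_seq.
Qed.

Lemma tneqE d b (v : vertex) :
  tneq d b (enc_nat v) enc_env = enc_clauses (neq_clauses names d b v).
Proof.
elim: d b v => [|d IH] b v /=; rewrite tnameE truth_option; case: name => //=.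
exact: tgate_clausesE.
Qed.

Lemma tdefE d (v : vertex) : tdef d (enc_nat v) enc_env = enc_clauses (def_clauses names d v).
Proof.
rewrite /tdef tnameE truth_option /def_clauses; case: name => [r|] //=.
rewrite !(tgate_clausesE (f := neq_clauses names d)); try exact: tneqE.
rewrite /enc_clauses -[RHS]tcat_seq; congr tcat; exact: tflat_seq.
Qed.

Lemma tclausesE d : tclauses d (enc_nat (out C)) enc_env = enc_clauses (circuit_clauses C names d).
Proof.
rewrite /tclauses tneqE /enc_clauses /circuit_clauses -[RHS]tcat_seq; congr tcat.
by apply: tflat_seq => e /=; rewrite tdefE.
Qed.
End Encoding.

(** * Search for the cut *)

(** Numbering starts at the end because the search decides the last vertex first: a new bit in front
    leaves the earlier names unchanged. *)
Fixpoint names_of (bs : seq bool) : seq (option nat) :=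
  if bs is b :: s then (if b then Some (count id s) else None) :: names_of s else [::].

Lemma names_of_lt bs v r : nth None (names_of bs) v = Some r -> r < count id bs.
Proof.
elim: bs v => [|b s IH] [|v] //=; last by move=> /IH; case: b; lia.
by case: b => // -[<-]; rewrite add1n.
Qed.

Lemma names_of_inj bs u v r :
  nth None (names_of bs) u = Some r -> nth None (names_of bs) v = Some r -> u = v.
Proof.
elim: bs u v => [|b s IH] [|u] [|v] //=.
- by case: b => // -[<-] /names_of_lt; rewrite ltnn.
- by case: b => // /names_of_lt lt [E]; rewrite E ltnn in lt.
- by move=> Hu Hv; rewrite (IH u v).
Qed.

Lemma names_of_nth bs v : (nth None (names_of bs) v != None) = nth false bs v.
Proof. by elim: bs v => [|[] s IH] [|v] //=. Qed.

(* The number of nodes of a search tree for a set of at most [w] among [m] vertices. *)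
Fixpoint nodes (m w : nat) : nat :=
  if m is m'.+1 then (nodes m' w + (if w is w'.+1 then nodes m' w' else 0)).+1 else 1.

Lemma size_enc_nat n : tree_size (enc_nat n) = n.*2.+1.
Proof. by elim: n => //= n ->; rewrite doubleS. Qed.

Lemma size_names bs n : size bs <= n ->
  tree_size (enc_seq enc_option (names_of bs)) <= (size bs) * (n.*2 + 4) + 1.
Proof.
elim: bs => //= b s IH lt; have {}IH := IH (ltnW lt).
have : tree_size (enc_option (if b then Some (count id s) else None)) <= n.*2 + 3.
  by case: b; rewrite /= ?size_enc_nat; have := count_size id s; lia.
by rewrite mulSn; lia.
Qed.

Section Search.
Variables (q d : nat).
Hypothesis q_gt0 : 0 < q.

(** A frame of the depth-first search: the first [i] vertices are undecided, [w] is the remaining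
    budget, [r] the next free name, and [names] belongs to the vertices already decided. *)
Definition tframe (i w r names : tree) : tree := Node i (Node w (Node r names)).

Definition tstate (stack res x : tree) : tree := Node stack (Node res x).

(** The budget is counted in wires and a marked gate costs [q], which avoids a division; dropping
    [q.-1] tests whether [w] is at least [q]. Inputs are always marked, free of charge. *)
Definition tpush (x : tree) (v w r names stack : tree) : tree :=
  let stay := Node (tframe v w r (Node Leaf names)) stack in
  let mark w := tframe v w (Node Leaf r) (Node (Node r Leaf) names) in
  if truth (tpreds v (left_tree (right_tree x))) then
    if truth (iter q.-1 right_tree w) then Node (mark (iter q right_tree w)) stay else stay
  else Node (mark w) stack.

Definition tvisit (f stack res x : tree) : tree :=
  let i := left_tree f in
  let w := left_tree (right_tree f) in
  let r := left_tree (right_tree (right_tree f)) in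
  let names := right_tree (right_tree (right_tree f)) in
  if truth i then tstate (tpush x (right_tree i) w r names stack) res x
  else tstate stack (if truth (tbad d (Node names (right_tree x))) then res else Node r names) x.

Definition tstep (s : tree) : tree :=
  tvisit (left_tree (left_tree s)) (right_tree (left_tree s))
    (left_tree (right_tree s)) (right_tree (right_tree s)).

Lemma FP_iter_right n f : FP f -> FP (fun x => iter n right_tree (f x)).
Proof. by move=> Hf; elim: n => //= n IH; apply: FP_right. Qed.

Lemma FP_step : FP tstep.
Proof.
rewrite /tstep /tvisit /tpush /tstate /tframe.
have Hp f g : FP f -> FP g -> FP (fun x => tpreds (f x) (g x)) := @FP_preds f g.
have Hb f : FP f -> FP (fun x => tbad d (f x)) := @FP_bad d f.
have Hi n f : FP f -> FP (fun x => iter n right_tree (f x)) := @FP_iter_right n f.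
by repeat first [apply: Hp | apply: Hb | apply: Hi | exact: FP_id | exact: FP_const
  | apply: FP_node | apply: FP_left | apply: FP_right | apply: FP_if].
Qed.

Definition tcount (l : tree) : tree := tflat (fun _ _ => Node Leaf Leaf) l Leaf.

Lemma tcount_seq (A : Type) (enc : A -> tree) s : tcount (enc_seq enc s) = enc_nat (size s).
Proof.
rewrite /tcount (tflat_seq (encB := fun _ : unit => Leaf) (f := fun _ => [:: tt])) //.
by elim: s => //= a s ->.
Qed.

Definition tinit (x : tree) : tree :=
  tstate (Node (tframe (tcount (right_tree (right_tree x))) (tcount (left_tree (right_tree x)))
                 Leaf Leaf) Leaf) Leaf x.

Lemma FP_init : FP tinit.
Proof. by rewrite /tinit /tstate /tframe /tcount; fp. Qed.

Definition tfinal (s : tree) : tree :=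
  let res := left_tree (right_tree s) in
  let x := right_tree (right_tree s) in
  Node (left_tree res) (tclauses d (left_tree x) (Node (right_tree res) (right_tree x))).

Lemma FP_final : FP tfinal.
Proof. by apply: FP_node; [fp|apply: FP2_clauses; fp]. Qed.

Section Instance.
Variable C : circuit.
Local Notation N := (Defs.order (dag C)).
Local Notation Q := (size (edges (dag C))).

Definition inputb (k : nat) : bool :=
  if insub k is Some v then is_input (v : 'I_N) else false.

Lemma truth_preds k : k < N -> truth (tpreds (enc_nat k) (enc_edges C)) = ~~ inputb k.
Proof.
move=> lt; rewrite /inputb insubT /= (tpredsE (Ordinal lt)) truth_seq.
by rewrite /is_input lt0n.
Qed.

(* A list of bits of length at most [N] describes the last vertices. *)
Fixpoint extra (bs : seq bool) : nat :=
  if bs is b :: s then (b && ~~ inputb (N - (size s).+1)) + extra s else 0.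
Fixpoint forced (bs : seq bool) : bool :=
  if bs is b :: s then (inputb (N - (size s).+1) ==> b) && forced s else true.
Definition good (bs : seq bool) : bool :=
  all (fun e => ok_children (names_of bs) d e.2) (edges (dag C)).
Definition admissible (bs : seq bool) : bool :=
  [&& size bs == N, forced bs, q * extra bs <= Q & good bs].

Definition enc_names (bs : seq bool) : tree := enc_seq enc_option (names_of bs).
Definition enc_frame (i w : nat) (bs : seq bool) : tree :=
  tframe (enc_nat i) (enc_nat w) (enc_nat (count id bs)) (enc_names bs).
Definition enc_result (bs : seq bool) : tree :=
  Node (enc_nat (count id bs)) (enc_names bs).
Definition result (res : tree) : Prop :=
  res = Leaf \/ exists2 bs, admissible bs & res = enc_result bs.

(** Some leaf of the search tree below the frame carries a good cut; [t] holds the bits of the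
    undecided vertices. *)
Definition extends (i w : nat) (bs : seq bool) : Prop :=
  exists t, [/\ size t = i, forced (t ++ bs), q * extra (t ++ bs) <= q * extra bs + w
              & good (t ++ bs)].

Definition frame_bound : nat := N * (N.*2 + 4) + N.*2 + N.*2 + Q.*2 + 10.

Lemma size_frame i w bs : i <= N -> w <= Q -> size bs <= N ->
  tree_size (enc_frame i w bs) <= frame_bound.
Proof.
move=> iN wQ bN; rewrite /= !size_enc_nat.
have := size_names bN; rewrite -/(enc_names bs).
have : size bs * (N.*2 + 4) <= N * (N.*2 + 4) by rewrite leq_mul.
have := count_size id bs; rewrite /frame_bound.
by move: (N * _) (size bs * _) => u v; lia.
Qed.

Lemma size_result res : result res -> tree_size res <= frame_bound.
Proof.
case=> [->|[bs /and4P[/eqP sz _ _ _] ->]]; first by rewrite /= /frame_bound; lia.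
apply: leq_trans (size_frame (leq0n N) (leq0n Q) (eq_leq sz)).
by rewrite /enc_result /enc_frame /tframe /=; lia.
Qed.

Lemma extra_cat t bs : extra bs <= extra (t ++ bs).
Proof. by elim: t => //= b t; lia. Qed.

Lemma iter_right_nat n k : iter n right_tree (enc_nat k) = enc_nat (k - n).
Proof. by rewrite -tdrop_nat tdrop_natB. Qed.

Let x := enc_circuit C.

(** A frame is followed until it has left the stack. The rest of the stack is arbitrary, so the
    induction applies to the marked branch while [stay] waits below it. Depth-first search keeps at
    most one waiting frame per level: the states remain polynomial although the number of steps does
    not. *)
Lemma search i w bs stack res : i + size bs = N -> forced bs -> q * extra bs + w <= Q ->
  result res ->
  exists n res', [/\ n <= nodes i (w %/ q),
    iter n tstep (tstate (Node (enc_frame i w bs) stack) res x) = tstate stack res' x,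
    forall k, k < n -> not_halted (iter k tstep (tstate (Node (enc_frame i w bs) stack) res x)),
    forall k, k <= n -> tree_size (iter k tstep (tstate (Node (enc_frame i w bs) stack) res x)) <=
      tree_size stack + i.+1 * frame_bound.+1 + frame_bound + tree_size x + 2
  & result res' /\ (res <> Leaf \/ extends i w bs -> res' <> Leaf)].
Proof.
elim: i w bs stack res => [|i IH] w bs stack res iN fbs qw Hres.
  have res1 : result (if good bs then enc_result bs else res).
    case: ifP => // gbs; right; exists bs => //; apply/and4P; split=> //; first exact/eqP.
    by apply: leq_trans qw; apply: leq_addr.
  have stepE : tstep (tstate (Node (enc_frame 0 w bs) stack) res x) =
      tstate stack (if good bs then enc_result bs else res) x.
    rewrite /tstep /tvisit /= -/(enc_names bs).
    rewrite -[Node (enc_names bs) _]/(enc_env C (names_of bs)) tbadE -/(good bs).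
    by case: (good bs).
  exists 1, (if good bs then enc_result bs else res); split => //.
  - by case.
  - move=> [|[|//]] _; last rewrite iterS stepE; rewrite /=.
      have := size_frame (leq0n N) (leq_trans (leq_addl _ _) qw) (eq_leq iN).
      have := size_result Hres; rewrite /enc_frame /tframe /=.
      by move: frame_bound => M; lia.
    by have := size_result res1; move: frame_bound => M; lia.
  - split=> // -[rL|[t [/size0nil -> _ _ /= ->]]] //.
    by case: ifP.
have iN' : i < N by lia.
have NE : N - (size bs).+1 = i by lia.
pose st0 := tstate (Node (enc_frame i.+1 w bs) stack) res x.
have sz0 : tree_size st0 <= tree_size stack + i.+2 * frame_bound.+1 + frame_bound + tree_size x + 2.
  have := size_frame iN' (leq_trans (leq_addl _ _) qw) (leq_trans (leq_addl _ _) (eq_leq iN)).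
  have := size_result Hres; rewrite /st0 /tstate /= !mulSn.
  by rewrite /enc_frame /tframe /=; move: frame_bound => M; lia.
(* The bit of vertex [i] is the last one of [t], next to [bs]. *)
have extE t : size t = i.+1 -> exists t' b, size t' = i /\ t = rcons t' b.
  by case/lastP: t => // t' b; rewrite size_rcons => -[st']; exists t', b.
have extSt : extends i.+1 w bs -> ~~ inputb i ->
    extends i w (false :: bs) \/ (q <= w /\ extends i (w - q) (true :: bs)).
  move=> [t [/extE[t' [b [st' ->]]]]]; rewrite cat_rcons => ft qt gt ni.
  case: b in ft qt gt.
    right; have := leq_trans (leq_mul (leqnn q) (extra_cat t' (true :: bs))) qt.
    rewrite /= NE ni mulnDr muln1 => qw'; split; first by lia.
    by exists t'; split => //; rewrite /= NE ni mulnDr muln1; lia.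
  by left; exists t'; split.
have stayP : ~~ inputb i -> forall res0, result res0 ->
   exists n res', [/\ n <= nodes i (w %/ q),
    iter n tstep (tstate (Node (enc_frame i w (false :: bs)) stack) res0 x) = tstate stack res' x,
    forall k, k < n -> not_halted (iter k tstep (tstate (Node (enc_frame i w (false :: bs)) stack) res0 x)),
    forall k, k <= n -> tree_size (iter k tstep (tstate (Node (enc_frame i w (false :: bs)) stack) res0 x)) <=
      tree_size stack + i.+1 * frame_bound.+1 + frame_bound + tree_size x + 2
  & result res' /\ (res0 <> Leaf \/ extends i w (false :: bs) -> res' <> Leaf)].
  move=> ni res0 Hres0; apply: IH => //=; first by lia.
  by rewrite NE (negbTE ni).
(* Three cases: an input, which has to be marked; a gate too expensive for the budget; a gate that
   is tried both ways. *)
have [inp|ninp] := boolP (inputb i).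
  have stepE : tstep st0 = tstate (Node (enc_frame i w (true :: bs)) stack) res x.
    rewrite /tstep /tvisit /= -/(enc_nat i) /tpush /= -/(enc_nat i) truth_preds //.
    by rewrite inp /=.
  have [||||n [res' [nle nE nh nsz [Hres' ext]]]] := IH w (true :: bs) stack res.
  - by rewrite /=; lia.
  - by rewrite /= NE inp.
  - by rewrite /= NE inp.
  - by [].
  exists n.+1, res'; split; rewrite -/st0.
  - by rewrite /= ltnS; apply: leq_trans nle _; apply: leq_addr.
  - by rewrite iterSr stepE.
  - by move=> [//|k] lt; rewrite iterSr stepE; apply: nh.
  - move=> [_|k lt]; first exact: sz0.
    rewrite iterSr stepE; apply: leq_trans (nsz k lt) _.
    rewrite [_ * frame_bound.+1 in leqRHS]mulSn.
    by move: frame_bound => M; lia.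
  - split=> // H; apply: ext; case: H => [|[t [/extE[t' [b [st' ->]]] ft qt gt]]]; first by left.
    right; exists t'; rewrite cat_rcons in ft qt gt.
    have bT : b = true.
      have : forced (b :: bs).
        by move: ft; elim: (t') => //= b' s IHs /andP[_ /IHs].
      by rewrite /= NE inp; case: b {ft qt gt}.
    by subst b; split=> //; move: qt; rewrite /= NE inp.
have [qw'|wq] := leqP q w; last first.
  have stepE : tstep st0 = tstate (Node (enc_frame i w (false :: bs)) stack) res x.
    rewrite /tstep /tvisit /= -/(enc_nat i) /tpush /= -/(enc_nat i) truth_preds //.
    rewrite ninp /= /enc_frame /tframe /= -/(enc_nat w) iter_right_nat truth_nat.
    by rewrite (_ : (0 < _) = false) //; lia.
  have [n [res' [nle nE nh nsz [Hres' ext]]]] := stayP ninp res Hres.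
  exists n.+1, res'; split; rewrite -/st0.
  - by rewrite /= ltnS; apply: leq_trans nle _; apply: leq_addr.
  - by rewrite iterSr stepE.
  - by move=> [//|k] lt; rewrite iterSr stepE; apply: nh.
  - move=> [_|k lt]; first exact: sz0.
    rewrite iterSr stepE; apply: leq_trans (nsz k lt) _.
    rewrite [_ * frame_bound.+1 in leqRHS]mulSn.
    by move: frame_bound => M; lia.
  - split=> // H; apply: ext; case: H => [|/extSt[//||[qw' _]]]; [by left|by right|].
    by rewrite leqNgt wq in qw'.
pose stay := Node (enc_frame i w (false :: bs)) stack.
have stepE : tstep st0 = tstate (Node (enc_frame i (w - q) (true :: bs)) stay) res x.
  rewrite /tstep /tvisit /= -/(enc_nat i) /tpush /= -/(enc_nat i) truth_preds //.
  rewrite ninp /= /stay /enc_frame /tframe /= -/(enc_nat w) iter_right_nat truth_nat.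
  by rewrite (_ : (0 < _) = true) ?iter_right_nat //; lia.
have [||||n1 [res1 [n1le n1E n1h n1sz [Hres1 ext1]]]] := IH (w - q) (true :: bs) stay res.
- by rewrite /=; lia.
- by rewrite /= implybT.
- by rewrite /= NE (negbTE ninp) mulnDr; lia.
- by [].
have [n2 [res2 [n2le n2E n2h n2sz [Hres2 ext2]]]] := stayP ninp res1 Hres1.
have iterE k : iter (k + n1).+1 tstep st0 = iter k tstep (tstate stay res1 x).
  by rewrite iterSr stepE iterD n1E.
have stay_size : tree_size stay <= frame_bound + tree_size stack + 1.
  have := @size_frame i w (false :: bs) (ltnW iN') (leq_trans (leq_addl _ _) qw).
  by rewrite /stay /= => /(_ _)H; have := H _; rewrite (_ : size bs < N); [move=> /(_ isT); lia|lia].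
exists (n2 + n1).+1, res2; split; rewrite -/st0.
(* Paying [q] lowers the quotient by one, as in the recursion of [nodes]. *)
- have -> : w %/ q = ((w - q) %/ q).+1 by rewrite -{1}(subnK qw') divnDr // divnn q_gt0 addn1.
  rewrite /= ltnS; apply: leq_add => //.
  by rewrite -{1}(subnK qw') divnDr // divnn q_gt0 addn1 in n2le.
- by rewrite iterE.
- move=> [//|k] lt; case: (ltnP k n1) => [kn|nk]; first by rewrite iterSr stepE; apply: n1h.
  by rewrite -(subnK nk) iterE; apply: n2h; lia.
- move=> [_|k lt]; first exact: sz0.
  rewrite [_ * frame_bound.+1 in leqRHS]mulSn.
  case: (leqP k n1) => [kn|nk].
    rewrite iterSr stepE; apply: leq_trans (n1sz k kn) _.
    by move: frame_bound stay_size => M; lia.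
  rewrite -(subnK (ltnW nk)) iterE; apply: leq_trans (n2sz _ _) _; first by lia.
  by move: frame_bound => M; lia.
split=> // H; apply: ext2; case: H => [rL|/extSt[//||[_ e]]].
- by left; apply: ext1; left.
- by right.
- by left; apply: ext1; right.
Qed.
End Instance.
End Search.

Lemma extra_iota C f i n : i + n = Defs.order (dag C) ->
  extra C (map f (iota i n)) = count (fun k => f k && ~~ inputb C k) (iota i n).
Proof.
elim: n i => //= n IH i E; rewrite size_map size_iota IH; last by lia.
by rewrite (_ : Defs.order _ - _ = i) //; lia.
Qed.

Lemma forced_iota C f i n : i + n = Defs.order (dag C) ->
  forced C (map f (iota i n)) = all (fun k => inputb C k ==> f k) (iota i n).
Proof.
elim: n i => //= n IH i E; rewrite size_map size_iota IH; last by lia.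
by rewrite (_ : Defs.order _ - _ = i) //; lia.
Qed.

(** For the number of variables of the formula: these are all the inputs and the marked gates. *)
Lemma count_forced C bs : size bs <= Defs.order (dag C) -> forced C bs ->
  count id bs = extra C bs +
    count (inputb C) (iota (Defs.order (dag C) - size bs) (size bs)).
Proof.
elim: bs => //= b s IH lt /andP[fb fs]; rewrite IH //; last exact: ltnW.
rewrite (_ : (Defs.order (dag C) - (size s).+1).+1 = Defs.order (dag C) - size s); last by lia.
by case: b fb; case: (inputb C _) => //= _; lia.
Qed.

Lemma forced_nth C bs k : forced C bs -> size bs <= Defs.order (dag C) -> k < size bs ->
  inputb C (Defs.order (dag C) - size bs + k) -> nth false bs k.
Proof.
elim: bs k => // b s IH [|k] /= /andP[fb fs] lt kb inp.
  by rewrite addn0 in inp; rewrite inp in fb.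
apply: IH => //; first exact: ltnW.
by rewrite -(_ : Defs.order (dag C) - (size s).+1 + k.+1 = Defs.order (dag C) - size s + k) //; lia.
Qed.

Lemma count_inputb C : count (inputb C) (iota 0 (Defs.order (dag C))) = num_inputs C.
Proof.
rewrite -val_enum_ord count_map enumT /num_inputs cardE /enum_mem size_filter.
by apply: eq_count => v; rewrite /= /inputb valK.
Qed.

(** For [K = 2 * q] the laminar cut removes at most [circuit_size C / q] wires, which fits the
    budget. A vertex that is not [ok] at depth [d] ends a path of [d] remaining wires, and the depth
    chosen here exceeds the longest such path by one. *)
Lemma fine_exists q (C : circuit) : 0 < q -> VSP (dag C) ->
  extends q (2 * (2 * q) * 4 ^ (2 * q)).+3 C (Defs.order (dag C)) (circuit_size C) [::].
Proof.
move=> q0 [_ [l [lab _ lam]]].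
pose lab2 (e : 'I_(Defs.order (dag C)) * 'I_(Defs.order (dag C))) := (l e.1, l e.2).
pose I := map lab2 (edges (dag C)).
have ltI : {in I, forall e : nat * nat, e.1 < e.2} by move=> _ /mapP[e eE ->]; apply: lab.
have lamI : {in I &, forall e e' : nat * nat, ~~ [&& e.1 < e'.1, e'.1 < e.2 & e.2 < e'.2]}.
  by move=> _ _ /mapP[e eE ->] /mapP[e' eE' ->]; apply: lam.
have [|S [Sw Sp]] := laminar_cut ltI lamI (K := 2 * q); first by lia.
pose tails := [seq e.1 | e <- edges (dag C) & S (lab2 e)].
pose f k := inputb C k || (k \in map val tails).
have nthf (v : 'I_(Defs.order (dag C))) : nth false (map f (iota 0 (Defs.order (dag C)))) v = f v.
  by rewrite (nth_map 0) ?size_iota // nth_iota.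
set bs := map f _ in nthf; exists bs; rewrite cats0; split.
- by rewrite size_map size_iota.
- by rewrite forced_iota //; apply/allP => k _; rewrite /f; apply/implyP => ->.
- rewrite muln0 add0n extra_iota //.
  apply: (@leq_trans (q * count S I)); last first.
    by move: Sw; rewrite size_map -mulnA leq_pmul2l.
  (* Marked gates are tails of removed wires, and these are counted with multiplicity. *)
  have -> : count S I = size (map val tails) by rewrite !size_map size_filter count_map.
  rewrite leq_mul // -size_filter.
  apply: uniq_leq_size; first by rewrite filter_uniq // iota_uniq.
  by move=> k; rewrite mem_filter /f => /andP[/andP[/orP[->|->]]].
have long d v : ~~ ok (names_of bs) d v -> exists x s,
    [/\ path (avoid I S) x s, last x s = l v & size s = d].
  elim: d v => [|d IH] v; first by exists (l v), [::].
  rewrite /= negb_or => /andP[_].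
  have kid i : ~~ child (ok (names_of bs) d) true i v ->
      exists2 u, adj u v & ~~ ok (names_of bs) d u.
    rewrite /child; case E: drop => [//|u s]; exists u => //.
    have : u \in drop i (preds v) by rewrite E mem_head.
    by move/mem_drop => /mapP[[u' v'] ]; rewrite mem_filter /= => /andP[/eqP-> ?] ->.
  have step u : adj u v -> ~~ ok (names_of bs) d u -> exists x s,
      [/\ path (avoid I S) x s, last x s = l v & size s = d.+1].
    move=> uv nok; have [x [s [p e sz]]] := IH u nok.
    exists x, (rcons s (l v)); rewrite rcons_path last_rcons size_rcons sz e p; split => //=.
    rewrite /avoid /=; apply/andP; split; first by apply/mapP; exists (u, v).
    (* The tail of a removed wire is marked, whereas [u] is unnamed because it is not [ok]. *)
    apply/negP => Suv; suff : name (names_of bs) u != None.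
      by move: nok; case: (d) => [|d'] /=; case: eqP.
    rewrite /name names_of_nth nthf /f; apply/orP; right.
    apply/mapP; exists u => //; apply/mapP; exists (u, v) => //.
    by rewrite mem_filter Suv.
  by rewrite negb_and => /orP[/kid[u]|/kid[u]]; apply: step.
have okP (v : 'I_(Defs.order (dag C))) : ok (names_of bs) (2 * (2 * q) * 4 ^ (2 * q)).+3 v.
  apply/negPn/negP => /long[x [s [p _ sz]]].
  by have := Sp _ _ p; rewrite sz !addSn add0n ltnn.
apply/allP => e _; rewrite /ok_children /child.
by apply/andP; split; case: drop => // u s.
Qed.

(** Indices out of range would be dropped; the lemmas below assume that all are less than [n]
    wherever this matters. *)
Definition literals_of n (cl : seq literal) : seq (bool * 'I_n) :=
  pmap (fun p => omap (pair p.1) (insub p.2)) cl.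

Definition cnf_of n (cls : seq (seq literal)) : cnf := Cnf (map (literals_of n) cls).

Lemma literals_of_cons n (p : literal) cl (lt : p.2 < n) :
  literals_of n (p :: cl) = (p.1, Ordinal lt) :: literals_of n cl.
Proof. by rewrite /literals_of /= insubT. Qed.

Lemma enc_cnf_of n cls : all (all (fun p : literal => p.2 < n)) cls ->
  enc_cnf (cnf_of n cls) = Node (enc_nat n) (enc_clauses cls).
Proof.
move=> H; congr Node; rewrite /= /enc_clauses; elim: cls H => //= cl cls IH /andP[Hcl /IH ->].
congr Node; elim: cl Hcl => // p cl IHcl /andP[lt /IHcl E].
by rewrite (literals_of_cons _ lt) /= -E.
Qed.

Lemma cnf_of_width k n cls : all (fun cl : seq literal => size cl <= k) cls ->
  is_kcnf k (cnf_of n cls).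
Proof.
move=> H; rewrite /is_kcnf /= all_map; apply: sub_all H => cl /=.
apply: leq_trans; rewrite /literals_of size_pmap.
exact: count_size.
Qed.

Lemma cnf_of_sat n cls : all (all (fun p : literal => p.2 < n)) cls ->
  cnf_sat (cnf_of n cls) <-> exists y, sat y cls.
Proof.
move=> H.
have E (x : {ffun 'I_n -> bool}) (y : nat -> bool) : (forall i : 'I_n, y i = x i) ->
    @cnf_eval (cnf_of n cls) x = sat y cls.
  move=> xy; rewrite /cnf_eval /sat /= all_map.
  apply: eq_in_all => cl /(allP H) Hcl; rewrite /= /holds.
  elim: cl Hcl => // p cl IH /andP[lt /IH Ecl].
  by rewrite (literals_of_cons _ lt) /= Ecl -xy.
split=> [/existsP[x]|[y]].
  rewrite (E x (fun k => if insub k is Some i then x i else false)) => [|i]; last by rewrite valK.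
  by move=> Hy; eexists; exact: Hy.
rewrite -(E [ffun i => y (val i)]) => [Hy|i]; last by rewrite ffunE.
by apply/existsP; eexists; exact: Hy.
Qed.

Lemma size_enc_seq_ge (A : Type) (enc : A -> tree) s : size s < tree_size (enc_seq enc s).
Proof. by elim: s => //= a s; lia. Qed.

Lemma order_lt_size C : Defs.order (dag C) < tree_size (enc_circuit C).
Proof.
rewrite -[X in X < _](size_enum_ord (Defs.order (dag C))).
apply: leq_trans (size_enc_seq_ge _ _) _; apply: leqW.
by apply: leq_trans _ (leq_addl _ _); apply: leqW; apply: leq_addl.
Qed.

Lemma circuit_size_lt C : circuit_size C < tree_size (enc_circuit C).
Proof.
apply: leq_trans (size_enc_seq_ge _ _) _; apply: leqW.
by apply: leq_trans _ (leq_addl _ _); apply: leqW; apply: leq_addr.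
Qed.

Lemma frame_arith t N Q p : N < t -> Q < t -> 2 <= t -> 2 ^ 5 <= p ->
  N * (N.*2 + 4) + N.*2 + N.*2 + Q.*2 + 10 <= t * t * p.
Proof.
move=> NB QB t2 p5.
have : t * t * 2 ^ 5 <= t * t * p by rewrite leq_mul.
have : N * (N.*2 + 4) <= t * (t.*2 + 4) by apply: leq_mul; lia.
by nia.
Qed.

Lemma state_arith t u v f p r : u + 2 = t -> 2 ^ 4 <= r -> t <= p -> f <= p ->
  v <= t * p.+1 -> u + (1 + v + f + u + 2) + 2 <= t * p * r.
Proof.
move=> ut r4 tp fp vt.
have : t * p * 2 ^ 4 <= t * p * r by rewrite leq_mul.
have : 2 * p <= t * p by rewrite leq_mul //; lia.
by rewrite mulnS in vt; lia.
Qed.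

(** Since [k] is chosen before [C], the solver for one fixed [k] can be appended to the program. *)
Lemma reduction q : 0 < q -> exists k c a, forall C, VSP_circuit C ->
  exists phi, [/\ is_kcnf k phi, cnf_sat phi = circuit_sat C,
    nvars phi <= num_inputs C + circuit_size C %/ q,
    tree_size (enc_cnf phi) <= (tree_size (enc_circuit C)).+2 ^ a
  & runs c (enc_circuit C) (enc_cnf phi)
      (nodes (Defs.order (dag C)) (circuit_size C %/ q) * (tree_size (enc_circuit C)).+2 ^ a)].
Proof.
move=> q0; pose d := (2 * (2 * q) * 4 ^ (2 * q)).+3.
have [c [a Hc]] := runs_search FP_init (FP_step q d) (FP_final d).
have [b Hb] := FP_size (FP_final d).
(* States have size at most [s ^ 12], raised to the power [a] in the running time and [b] in the
   size of the result; the 1 absorbs the factor 2 in [n.+1 <= 2 * nodes]. *)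
exists (2 ^ d.+1).+1, c, (12 * a + 12 * b + 1) => C [VC _ _].
have ext := fine_exists q0 VC; rewrite -/d in ext.
set x := enc_circuit C; set s := (tree_size x).+2.
have [||||n [res [nle nE nh nsz [Hres Hext]]]] :=
    @search q d q0 C (Defs.order (dag C)) (circuit_size C) [::] Leaf Leaf.
- by rewrite addn0.
- by [].
- by rewrite muln0 add0n.
- by left.
have initE : tinit x =
    tstate (Node (enc_frame (Defs.order (dag C)) (circuit_size C) [::]) Leaf) Leaf x.
  by rewrite /tinit /= !tcount_seq size_enum_ord.
rewrite -/x -initE in nE nh nsz.
have {Hres Hext} [bs /and4P[/eqP sbs fbs qbs gbs] resE] :
    exists2 bs, admissible q d C bs & res = enc_result bs.
  by case: Hres => // resL; case: (Hext (or_intror ext)).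
pose cls := circuit_clauses C (names_of bs) d.
have clsP : all (fun cl => all (fun p : literal => p.2 < count id bs) cl &&
    (size cl <= (2 ^ d.+1).+1)) cls.
  by apply: circuit_clauses_all => v r b' /names_of_lt.
have cls_lt : all (all (fun p : literal => p.2 < count id bs)) cls.
  by apply: sub_all clsP => cl /andP[].
have finE : tfinal d (iter n (tstep q d) (tinit x)) = enc_cnf (cnf_of (count id bs) cls).
  by rewrite nE enc_cnf_of // /tfinal resE /= -tclausesE.
pose M := 1 + (Defs.order (dag C)).+1 * (frame_bound C).+1 + frame_bound C + tree_size x + 2.
have s2 : 2 <= s by [].
have sexp u v : u <= v -> s ^ u <= s ^ v by apply: leq_pexp2l.
(* A frame is quadratic in [s] up to a constant below [2 ^ 5], hence at most [s ^ 7]; at most [s]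
   frames count, and [s ^ 4] covers the remaining constants. *)
have MB : tree_size x + M + 2 <= s ^ 12.
  have NB : Defs.order (dag C) < s by do 2!apply: leqW; apply: order_lt_size.
  have QB : size (edges (dag C)) < s by do 2!apply: leqW; apply: circuit_size_lt.
  have fB : frame_bound C <= s ^ 7.
    have -> : s ^ 7 = s * s * s ^ 5 by rewrite -mulnA -!expnS.
    have : 2 ^ 5 <= s ^ 5 by rewrite leq_exp2r.
    by move=> p5; exact: frame_arith.
  have : (Defs.order (dag C)).+1 * (frame_bound C).+1 <= s * (s ^ 7).+1 by apply: leq_mul.
  have -> : s ^ 12 = s * s ^ 7 * s ^ 4 by rewrite -expnS -expnD.
  have : 2 ^ 4 <= s ^ 4 by rewrite leq_exp2r.
  have : s ^ 1 <= s ^ 7 by apply: sexp.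
  have sE : tree_size x + 2 = s by rewrite addn2.
  by rewrite /M expn1 => H1 H2 H3; apply: state_arith sE H2 H1 fB H3.
have satE : circuit_sat C <-> exists y, sat y cls.
  case: VC => acy [l [lab _ _]].
  apply: (circuit_satP acy lab) => [v vi|u v r Hu Hv|e eE].
  - rewrite /name names_of_nth; apply: (forced_nth fbs); rewrite sbs // subnn add0n.
    by rewrite /inputb valK.
  - by apply: val_inj; apply: names_of_inj Hu Hv.
  - by move: gbs => /allP /(_ e eE).
exists (cnf_of (count id bs) cls); split.
- by apply: cnf_of_width; apply: sub_all clsP => cl /andP[].
- apply/idP/idP => [/(cnf_of_sat cls_lt) H|H]; first exact/satE.
  exact/(cnf_of_sat cls_lt)/satE.
- rewrite /= (count_forced _ fbs) ?sbs // subnn count_inputb addnC leq_add2l.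
  by rewrite leq_divRL // mulnC.
- rewrite -finE; apply: leq_trans (Hb _) _.
  apply: (@leq_trans ((s ^ 12) ^ b)); last by rewrite -expnM sexp //; lia.
  case: (b) => // b'; rewrite leq_exp2r //; apply: leq_trans MB.
  by have := nsz n (leqnn n); rewrite /M /=; lia.
rewrite -finE; apply: runs_le.
  by apply: (Hc _ _ M) => //; rewrite nE.
apply: (@leq_trans (2 * nodes (Defs.order (dag C)) (circuit_size C %/ q) * (s ^ 12) ^ a)).
  apply: leq_mul; last by case: (a) => // a'; rewrite leq_exp2r //; lia.
  apply: leq_ltn_trans nle _; set m := nodes _ _; suff : 0 < m by lia.
  by rewrite /m; case: (Defs.order _).
rewrite [2 * _]mulnC -mulnA leq_mul //; apply: (@leq_trans (s * (s ^ 12) ^ a)).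
  by rewrite leq_mul.
by rewrite -expnM -expnS sexp //; lia.
Qed.

(** * Running times and error probabilities *)

Lemma steps_coins T k s r r' : (forall j, j < T -> nth false r j = nth false r' j) ->
  (iter T step (k, s, r)).1 = (iter T step (k, s, r')).1.
Proof.
elim: T k s r r' => // T IH k s r r' rr'; rewrite !iterSr.
have same : forall j, j < T -> nth false r j = nth false r' j.
  by move=> j jT; apply: rr'; apply: ltnW.
have next : forall j, j < T -> nth false (behead r) j = nth false (behead r') j.
  by move=> j jT; rewrite !nth_behead; apply: rr'.
case: k => [|[|x e|x|a b|e a b|e a] k] /=; try exact: IH.
by rewrite -!nth0 rr' //; apply: IH.
Qed.

Lemma run_coins prog T x r r' : (forall j, j < T -> nth false r j = nth false r' j) ->
  run prog T x r = run prog T x r'.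
Proof.
move=> /steps_coins H; rewrite /run.
have := H [:: prog] (fun y => if y == 0 then x else Leaf).
case: (iter T step (_, _, r)) => [[k s] ?].
by case: (iter T step (_, _, r')) => [[k' s'] ?] /= [-> ->].
Qed.

(** The composed program has more steps, hence formally more coins, than the solver; this shows that
    the surplus does not change the error. *)
Lemma card_take (P : pred (seq bool)) T m :
  #|[pred r : (T + m).-tuple bool | P (take T r)]| = #|[pred r : T.-tuple bool | P r]| * 2 ^ m.
Proof.
pose f (u : T.-tuple bool * m.-tuple bool) : (T + m).-tuple bool := [tuple of u.1 ++ u.2].
have f_inj : injective f.
  move=> [u v] [u' v'] /(congr1 val) /= /eqP; rewrite eqseq_cat ?size_tuple //.
  by case/andP => /eqP/val_inj-> /eqP/val_inj->.
have -> : 2 ^ m = #|{: m.-tuple bool}| by rewrite card_tuple card_bool.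
rewrite -cardX -(fintype.card_image f_inj); apply: eq_card => r; rewrite inE.
apply/idP/fintype.imageP => [Pr|[[u v] Puv ->]].
  have sz1 : size (take T r) == T by rewrite size_takel // size_tuple leq_addr.
  have sz2 : size (drop T r) == m by rewrite size_drop size_tuple addKn.
  exists (Tuple sz1, Tuple sz2); first by rewrite !inE /= Pr.
  by apply: val_inj; rewrite /= cat_take_drop.
move: Puv; rewrite !inE andbT /= take_cat size_tuple ltnn subnn take0 cats0.
by [].
Qed.

(** Every gate is the head of some wire. Hence the search runs over linearly many vertices in
    [n]. *)
Lemma order_le C : Defs.order (dag C) <= num_inputs C + circuit_size C.
Proof.
rewrite -[X in X <= _]card_ord -(cardC [pred v : 'I_(Defs.order (dag C)) | is_input v]) leq_add2l.
rewrite cardE /circuit_size -(size_map snd); apply: uniq_leq_size; first exact: enum_uniq.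
move=> v; rewrite mem_enum inE /= => /not_input_edge[e eE <-].
exact: map_f.
Qed.

(** The reduction reads no coins, so the solver gets [r] intact; the additional step unfolds
    [Seq]. *)
Lemma runs_then c prog x y T : runs c x y T -> exists2 t, t <= T
  & forall T0 r, run (Seq c prog) (T0 + t.+1) x r = run prog T0 y r.
Proof.
move=> [t tT H]; exists t => // T0 r; rewrite /run.
by rewrite iterD iterSr /= -[fun y => _]/(st x) H.
Qed.

Section Real.
Local Open Scope ring_scope.
Variable R : realType.

(** This stands in for an entropy estimate of binomial sums: [b ^ m * g ^ w] dominates the recursion
    as soon as [g + 1 <= b * g], and the factor [m.+1] absorbs the successor. It serves with [b]
    close to 1 and [g] correspondingly large. *)
Lemma nodes_le (b g : R) m w : 1 <= b -> 1 <= g -> g + 1 <= b * g ->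
  (nodes m w)%:R <= m.+1%:R * b ^+ m * g ^+ w.
Proof.
move=> b1 g1 bg; elim: m w => [|m IH] w /=.
  by rewrite expr0 !mul1r exprn_ege1.
have b1' : 1 <= b ^+ m by apply: exprn_ege1.
case: w => [|w].
  have := IH 0%N; rewrite expr0 !mulr1 addn0 -[(nodes m 0).+1%:R]natr1 exprS -[m.+2%:R]natr1.
  have : 0 <= m.+1%:R * b ^+ m by apply: mulr_ge0; [|lra].
  move: (m.+1%:R) (ler0n R m.+1) => M M0.
  move: (b ^+ m) b1' => B B1 MB H.
  have : M * B <= M * B * b by rewrite ler_peMr.
  have : 1 <= b * B by nra.
  by nra.
have := IH w; have := IH w.+1.
rewrite -[(_ + _).+1%:R]natr1 natrD exprS [b ^+ m.+1]exprS -[m.+2%:R]natr1.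
have g1' : 1 <= g ^+ w by apply: exprn_ege1.
move: (m.+1%:R) (ler0n R m.+1) => M M0.
move: (b ^+ m) b1' (g ^+ w) g1' => B B1 G G1 H1 H2.
have : M * B * G * (g + 1) <= M * B * G * (b * g).
  by apply: ler_wpM2l => //; do !apply: mulr_ge0 => //; lra.
have : 1 <= b * B * (g * G).
  have : 1 <= b * B by nra. have : 1 <= g * G by nra. by nra.
by nra.
Qed.

(** The polynomial of the solver need not be monotone, and the size of the formula is known only up
    to an upper bound. *)
Lemma poly_le_norm (p : {poly R}) (x y : R) : 0 <= x -> x <= y ->
  p.[x] <= (map_poly (fun a => `|a|) p).[y].
Proof.
move=> x0 xy; rewrite horner_coef (horner_coef_wide _ (size_poly _ _)).
apply: ler_sum => i _; rewrite coef_map_id0 ?normr0 //.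
apply: le_trans (ler_norm _) _; rewrite normrM (ger0_norm (exprn_ge0 i x0)).
by rewrite ler_wpM2l // lerXn2r // nnegrE // (le_trans x0).
Qed.

Lemma error_prob_take P (P' : problem) prog prog' T m (x : instance P) (x' : instance P') :
  (forall r, run prog' (T + m) (encode x') r = run prog T (encode x) r) ->
  answer x = answer x' ->
  error_prob R prog' (T + m) x' = error_prob R prog T x.
Proof.
move=> H A; rewrite /error_prob.
have -> : #|[pred r : (T + m).-tuple bool | run prog' (T + m) (encode x') r != Some (answer x')]|
   = (#|[pred r : T.-tuple bool | run prog T (encode x) r != Some (answer x)]| * 2 ^ m)%N.
  rewrite -(card_take (fun r => run prog T (encode x) r != Some (answer x))).
  apply: eq_card => r; rewrite !inE H A; congr (_ != _).
  by apply: run_coins => j jT; rewrite nth_take.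
by rewrite !card_tuple card_bool expnD !natrM -mulf_div divff ?mulr1.
Qed.

Lemma solvable_le (P : problem) (e e' : R) : e <= e' -> solvable_in P e -> solvable_in P e'.
Proof.
move=> ee' [prog [p H]]; exists prog, p => x /H[T [T1 T2 T3]]; exists T; split=> //.
have pow0 : 0 < 2 `^ (e * (param x)%:R) :> R by rewrite powR_gt0.
have p0 : 0 <= p.[(input_size x)%:R].
  by rewrite -(pmulr_rge0 _ pow0); apply: le_trans T1; apply: ler0n.
apply: (le_trans T1); rewrite ler_wpM2r // ler_powR //; first by lra.
by rewrite ler_wpM2r.
Qed.

Lemma solvable_VSP (c : nat) (e e' : R) : 0 < e' -> e' < e ->
  (forall k, solvable_in (kCNF_SAT k) e') -> solvable_in (VSP_CIRCUIT_SAT (c%:R : R)) e.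
Proof.
move=> e'0 e'e solver; have e0 : 0 < e by apply: lt_trans e'e.
(* The order is at most [c.+1 * n], so with this [eta] the factor [b ^ order] uses half of the
   exponent [e]. *)
have [eta eta0 etaE] : exists2 eta : R, 0 < eta & eta * c.+1%:R = e / 2.
  by exists (e / 2 / c.+1%:R); [rewrite !divr_gt0|rewrite divfK // pnatr_eq0].
have [b bE b1] : exists2 b : R, b = 2 `^ eta & 1 < b.
  exists (2 `^ eta) => //; suff : 1 `^ eta < 2 `^ eta :> R by rewrite powR1.
  by apply: gt0_ltr_powR; rewrite ?nnegrE ?ltr1n.
have b10 : 0 < b - 1 by rewrite subr_gt0.
(* The condition [g + 1 <= b * g] amounts to [(b - 1)^-1 <= g]. *)
have [L [g [gE g1 gb]]] : exists L (g : R), [/\ g = 2 `^ L%:R, 1 <= g & g + 1 <= b * g].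
  pose L := (Num.truncn (b - 1)^-1).+1; exists L, (2 ^ L)%:R.
  split; [by rewrite powR_mulrn // natrX|by rewrite ler1n expn_gt0|].
  have H : (b - 1)^-1 <= (2 ^ L)%:R.
    apply: le_trans (ltW (truncnS_gt _)) _; rewrite ler_nat -/L; apply: ltnW.
    exact: ltn_expl.
  rewrite -lerBrDl -[X in b * _ - X]mul1r -mulrBl.
  by rewrite -[leLHS](mulfV (lt0r_neq0 b10)) ler_pM2l.
have ee' : 0 < e - e' by rewrite subr_gt0.
have e20 : 0 < e / 2 by rewrite divr_gt0.
(* The first inequality pays for the variables added by the cut out of the gap [e - e']; the second
   fits [g ^ w] into the other half of [e]. *)
have [q q_gt0 [qB1 qB2]] : exists2 q, (0 < q)%N &
    e' * c%:R <= q%:R * (e - e') /\ L%:R * c%:R <= q%:R * (e / 2).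
  pose v := Num.max (e' * c%:R / (e - e')) (L%:R * c%:R / (e / 2)).
  exists (Num.truncn v).+1 => //; have := truncnS_gt v; rewrite gt_max => /andP[H1 H2].
  by split; rewrite -ler_pdivrMr // ltW.
have [k [com [a Hred]]] := reduction q_gt0.
have [prog [p Hprog]] := solver k.
pose pn := map_poly (fun x => `|x|) p.
(* The summands bound the solver on a formula of size at most [(m + 2) ^ a], the reduction, and the
   step that unfolds [Seq]. *)
exists (Seq com prog), ((pn \Po ('X + 2%:P) ^+ a) + ('X + 2%:P) ^+ a.+1 + 1).
move=> C [VC size_C].
have [phi [kphi satE varE sizeE runE]] := Hred C VC.
have [t tT Hrun] := runs_then prog runE.
have [T0 [T0le T0run T0err]] := Hprog phi kphi.
exists (T0 + t.+1)%N; split; last first.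
- rewrite (@error_prob_take (kCNF_SAT k) _ prog _ T0 _ phi) //.
- move=> r; rewrite Hrun.
  have sz : size (take T0 r) == T0 by rewrite size_takel // size_tuple leq_addr.
  have := T0run (Tuple sz); rewrite /=; congr (_ != _).
  by apply: run_coins => j jT; rewrite nth_take.
set n : R := (num_inputs C)%:R in size_C *; set m : R := (input_size _)%:R.
have n0 : 0 <= n by apply: ler0n.
have m0 : 0 <= m by apply: ler0n.
have pow0 x : 0 < 2 `^ x :> R by rewrite powR_gt0.
have pow_le (x y : R) : x <= y -> 2 `^ x <= 2 `^ y :> R by move=> xy; rewrite ler_powR // ler1n.
set w := (circuit_size C %/ q)%N in varE runE tT.
have wq : w%:R * q%:R <= c%:R * n.
  by apply: le_trans size_C; rewrite -natrM ler_nat leq_divM.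
have q0 : 0 < q%:R :> R by rewrite ltr0n.
have scale (u v : R) : 0 <= u -> u * c%:R <= q%:R * v -> u * w%:R <= v * n.
  move=> u0 H; rewrite -(ler_pM2r q0) -mulrA; apply: (@le_trans _ _ (u * (c%:R * n))).
    by rewrite ler_wpM2l.
  by rewrite mulrA [leRHS]mulrAC ler_wpM2r // [leRHS]mulrC.
have e'c := scale _ _ (ltW e'0) qB1.
have Lw := scale _ _ (ler0n _ _) qB2.
have sE : m + 2 = (input_size (C : instance (VSP_CIRCUIT_SAT (c%:R : R)))).+2%:R.
  by rewrite -[X in _ = X%:R]addn2 natrD.
have nodesB : (nodes (Defs.order (dag C)) w)%:R <= (m + 2) * 2 `^ (e * n).
  apply: le_trans (nodes_le (b := b) (g := g) _ _ _ _ _) _ => //; first exact: ltW.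
  rewrite -mulrA; apply: ler_pM => //.
    by rewrite mulr_ge0 // exprn_ge0 // (le_trans ler01) // ltW.
    by rewrite sE ler_nat ltnS; apply: ltnW; apply: leqW; apply: order_lt_size.
  have -> : b ^+ Defs.order (dag C) = 2 `^ (eta * (Defs.order (dag C))%:R).
    by rewrite bE powRrM powR_mulrn ?powR_ge0.
  have -> : g ^+ w = 2 `^ (L%:R * w%:R).
    by rewrite gE powRrM [RHS]powR_mulrn ?powR_ge0.
  rewrite -powRD ?pnatr_eq0 ?implybT //; apply: pow_le.
  have : (Defs.order (dag C))%:R <= c.+1%:R * n.
    have := order_le C; rewrite -(ler_nat R) natrD -/n => H; apply: le_trans H _.
    by rewrite -natr1 mulrDl mul1r addrC lerD.
  rewrite -(ler_pM2l eta0) mulrA etaE => H.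
  by lra.
have tB : t%:R <= (m + 2) * 2 `^ (e * n) * (m + 2) ^+ a.
  apply: (@le_trans _ _ ((nodes (Defs.order (dag C)) w)%:R * (m + 2) ^+ a)).
    by rewrite sE -natrX -natrM ler_nat.
  by rewrite ler_wpM2r // exprn_ge0 // addr_ge0.
have T0B : T0%:R <= 2 `^ (e * n) * pn.[(m + 2) ^+ a].
  apply: (le_trans T0le).
  have pn_ge : p.[(input_size (phi : instance (kCNF_SAT k)))%:R] <= pn.[(m + 2) ^+ a].
    by apply: poly_le_norm => //; rewrite sE -natrX ler_nat.
  have pow_var : 2 `^ (e' * (param (phi : instance (kCNF_SAT k)))%:R) <= 2 `^ (e * n) :> R.
    apply: pow_le => /=; have : (nvars phi)%:R <= n + w%:R by rewrite -natrD ler_nat.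
    rewrite -(ler_pM2l e'0) mulrDr => H; lra.
  apply: (@le_trans _ _ (2 `^ (e' * (param (phi : instance (kCNF_SAT k)))%:R) * pn.[(m + 2) ^+ a])).
    by rewrite ler_wpM2l // powR_ge0.
  rewrite ler_wpM2r //; apply: le_trans pn_ge => //.
  rewrite -(pmulr_rge0 _ (pow0 (e' * (param (phi : instance (kCNF_SAT k)))%:R))).
  by apply: le_trans T0le.
rewrite natrD -natr1 !hornerE horner_comp !hornerE /= exprS.
have : 1 <= 2 `^ (e * n) :> R.
  by rewrite -[leLHS](powRr0 2) pow_le // mulr_ge0 // ltW.
have -> : m + 1 + 1 = m + 2 by rewrite -addrA.
move: T0B tB; set X := 2 `^ _; set Y := _ ^+ a; lra.
Qed.

Lemma sigma_ge0 P : (0 <= sigma R P)%E.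
Proof. by apply: le_ereal_inf_tmp => _ [e [e0 _] <-]; rewrite lee_fin ltW. Qed.

Lemma sigma_VSP_le (c s : R) :
  (forall k, (sigma R (kCNF_SAT k) <= s%:E)%E) -> (sigma R (VSP_CIRCUIT_SAT c) <= s%:E)%E.
Proof.
move=> H; have s0 : 0 <= s by rewrite -lee_fin; apply: le_trans (H 0%N); apply: sigma_ge0.
apply/lee_addgt0Pr => e e0.
have [c' cc'] : exists c' : nat, c <= c'%:R.
  by exists (Num.truncn c).+1; apply/ltW/truncnS_gt.
apply: (@le_trans _ _ (sigma R (VSP_CIRCUIT_SAT (c'%:R : R)))).
  by apply: sigma_le => C [? sz]; split=> //; apply: (le_trans sz); rewrite ler_wpM2r.
apply: ereal_inf_lbound; exists (s + e) => //; split; first by lra.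
(* Every width is solvable with exponent [s + e / 2], and the remaining [e / 2] is the gap that
   [solvable_VSP] needs. *)
apply: (@solvable_VSP c' (s + e) (s + e / 2)); [lra|lra|move=> k].
have : (sigma R (kCNF_SAT k) < (s + e / 2)%:E)%E.
  by apply: le_lt_trans (H k) _; rewrite lte_fin; lra.
move=> /ereal_inf_lt[_ [e1 [_ sol] <-]]; rewrite lte_fin => e1s.
exact: solvable_le (ltW e1s) sol.
Qed.
End Real.

Theorem theorem13 (R : realType) :
  (lim (sigma R (VSP_CIRCUIT_SAT c) @[c --> (+oo%R : set_system R)])%classic
     <= lim (sigma R (kCNF_SAT k) @[k --> \oo])%classic)%E.
Proof.
have mono_k : {homo (fun k => sigma R (kCNF_SAT k)) : k k' / (k <= k')%N >-> (k <= k')%E}.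
  by move=> k k' kk'; apply: sigma_le => phi; apply: sub_all => cl ?; apply: leq_trans kk'.
have mono_c : {homo (fun c : R => sigma R (VSP_CIRCUIT_SAT c)) : c c' / (c <= c')%R >-> (c <= c')%E}.
  move=> c c' cc'; apply: sigma_le => C [? sz]; split=> //.
  by apply: (le_trans sz); rewrite ler_wpM2r.
(* By monotonicity both limits are suprema, so each single size bound is compared with all widths at
   once. *)
rewrite (cvg_lim _ (nondecreasing_cvge mono_c)) //.
rewrite (cvg_lim _ (ereal_nondecreasing_cvgn mono_k)) //.
set s := (X in (_ <= X)%E).
have sk k : (sigma R (kCNF_SAT k) <= s)%E by apply: ereal_sup_ubound; exists k.
apply: ge_ereal_sup => _ [c _ <-].
case: s sk => [s||] sk; [exact: sigma_VSP_le|exact: leey|].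
by have := le_trans (sigma_ge0 R (kCNF_SAT 0)) (sk 0%N).
Qed.
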